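(* Let $\Gamma$ be the $\mathbb{Z}$-periodic graph with one-element fundamental cell (vertex set $\mathbb{Z}$, with $n$ and $n+k$ joined with weight $w(k)$) whose weights are given for $k\ge 0$ by $$w(k)=\begin{cases}\frac{1}{4k\sqrt{\log_2(2k)}}&\text{if }k=2^{n-1}\text{ for some integer }n\ge1,\\0&\text{otherwise,}\end{cases}$$ and $w(-k):=w(k)$. Then $\mathcal{A}_\Gamma$ and $\mathcal{L}_\Gamma$ have purely singular continuous spectrum.
   Context: On $\ell^2(\mathbb{Z})$, $(\mathcal{A}_\Gamma\psi)(n)=\sum_{k\in\mathbb{Z}}w(k)\psi(n+k)$ and $(\mathcal{L}_\Gamma\psi)(n)=\sum_{k\in\mathbb{Z}}w(k)(\psi(n)-\psi(n+k))$. *)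

(* Defs.v *)
From HB Require Import structures.
From mathcomp Require Import all_boot all_order all_algebra complex.
From mathcomp Require Import all_classical all_reals all_analysis.

Set Implicit Arguments.
Unset Strict Implicit.
Unset Printing Implicit Defensive.

Import Order.TTheory GRing.Theory Num.Theory.
Import numFieldNormedType.Exports.

Local Open Scope classical_set_scope.
Local Open Scope ring_scope.
Local Open Scope complex_scope.

Section SumsOverZ.
Variable R : realType.

(* Limit of the symmetric partial sums over -N <= k <= N.  All series to which
   it is applied here converge absolutely (terms of the form w(k) psi(n + k)
   with w summable and psi in l^2, or products of two l^2 sequences), so the
   order of summation is immaterial. *)
Definition zsum (f : int -> R) : R :=
  limn (fun N : nat => \sum_(0 <= j < N.*2.+1) f (j%:Z - N%:Z)).

Definition zsumC (f : int -> R[i]) : R[i] :=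
  zsum (fun k => complex.Re (f k)) +i* zsum (fun k => complex.Im (f k)).

End SumsOverZ.

Section Ell2.
Variable R : realType.
Implicit Types (phi psi : int -> R[i]) (H P : (int -> R[i]) -> int -> R[i]).

Definition ell2 psi : Prop :=
  summable [set: int]
    (fun n => (complex.Re (psi n) ^+ 2 + complex.Im (psi n) ^+ 2)%:E).

(* Conjugate-linear in the first argument. *)
Definition inner phi psi : R[i] := zsumC (fun n => (phi n)^* * psi n).

(* An operator on l^2(Z) is encoded as a map on all sequences, of which only
   the restriction to [ell2] is ever constrained or used. *)
Definition ell2_operator H : Prop :=
  (forall psi, ell2 psi -> ell2 (H psi)) /\
  (forall (a : R[i]) phi psi, ell2 phi -> ell2 psi ->
     H (fun n => a * phi n + psi n) = (fun n => a * H phi n + H psi n)).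

(* Being defined on all of l^2(Z), such an operator is automatically bounded
   (Hellinger-Toeplitz). *)
Definition selfadjoint_operator H : Prop :=
  ell2_operator H /\
  (forall phi psi, ell2 phi -> ell2 psi ->
     inner phi (H psi) = inner (H phi) psi).

Definition orthogonal_projection P : Prop :=
  selfadjoint_operator P /\ (forall psi, ell2 psi -> P (P psi) = P psi).

End Ell2.

Section SpectralType.
Variable R : realType.
Implicit Types (H : (int -> R[i]) -> int -> R[i]) (psi : int -> R[i]).
Implicit Types E : set (measurableTypeR R) -> (int -> R[i]) -> int -> R[i].
Implicit Types mu : {finite_measure set (measurableTypeR R) -> \bar R}.

(* mu is the measure A |-> <psi, E(A) psi>.  It is a relation, and not a
   function of E and psi, because only Borel sets A matter. *)
Definition scalar_spectral_measure E psi mu : Prop :=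
  forall A, measurable A -> inner psi (E A psi) = (fine (mu A))%:C.

(* The last clause is weak countable additivity; as the E(A) are orthogonal
   projections, it is equivalent to strong countable additivity. *)
Definition projection_valued_measure E : Prop :=
  [/\ forall A, measurable A -> orthogonal_projection (E A),
      forall psi, ell2 psi -> E setT psi = psi,
      forall A B psi, measurable A -> measurable B -> ell2 psi ->
        E (A `&` B) psi = E A (E B psi) &
      forall psi, ell2 psi -> exists mu, scalar_spectral_measure E psi mu].

(* H is the integral of x with respect to E, with domain all of l^2(Z).  By
   the spectral theorem there is exactly one such E (on Borel sets and on
   l^2(Z)) when H is bounded and self-adjoint. *)
Definition spectral_measure_of H E : Prop :=
  projection_valued_measure E /\
  (forall psi mu, ell2 psi -> scalar_spectral_measure E psi mu ->
     mu.-integrable setT (fun x : measurableTypeR R => ((x : R) ^+ 2)%:E) /\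
     inner psi (H psi) = (\int[mu]_(x in setT) (x : R))%:C).

(* The zero measure qualifies, so that the vectors whose spectral measure is
   singular continuous form the subspace H_sc. *)
Definition singular_continuous_measure mu : Prop :=
  (forall x : R, mu [set x] = 0%E) /\
  (exists N : set (measurableTypeR R),
     [/\ measurable N, lebesgue_measure N = 0%E & mu (~` N) = 0%E]).

(* H_sc is the whole space, i.e. H_pp = H_ac = 0. *)
Definition purely_singular_continuous_spectrum H : Prop :=
  selfadjoint_operator H /\
  exists E, spectral_measure_of H E /\
    forall psi mu, ell2 psi -> scalar_spectral_measure E psi mu ->
      singular_continuous_measure mu.

End SpectralType.

Section PeriodicGraph.
Variable R : realType.

(* The Z-periodic graph with vertex set Z in which n and n + k are joined with
   weight w k is represented by its weight function w. *)
Definition adjacency (w : int -> R) (psi : int -> R[i]) (n : int) : R[i] :=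
  zsumC (fun k => (w k)%:C * psi (n + k)).

Definition laplacian (w : int -> R) (psi : int -> R[i]) (n : int) : R[i] :=
  zsumC (fun k => (w k)%:C * (psi n - psi (n + k))).

Definition log2 (x : R) : R := ln x / ln 2.

Definition weight_nat (k : nat) : R :=
  if `[< exists n : nat, (1 <= n)%N /\ k = (2 ^ (n - 1))%N >]
  then (4 * k%:R * Num.sqrt (log2 (2 * k%:R)))^-1
  else 0.

Definition weight (k : int) : R := weight_nat `|k|%N.

End PeriodicGraph.

(* Main.v *)
(** The symbol [f x = \sum_(n >= 1) 2^-n n^(-1/2) cos (2 pi 2^(n-1) x)] of the
    adjacency operator is even.  In the Hartley basis
    [cos (2 pi n x) + sin (2 pi n x)] of the real space L^2(0, 1) multiplication
    by [f] is therefore the real Toeplitz matrix [w], which acts separately on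
    real and imaginary parts, and the Laplacian is multiplication by a constant
    minus [f].  The spectral projection [E(A)] is multiplication by [1_A \o f].
    That [E] is multiplicative needs Parseval's identity only for the functions
    [(1_A \o f) e_n]: these lie in the closed span of the basis because the
    [f e_n] do, hence also the [p(f) e_n] for polynomials [p] and, by bounded
    convergence, their limits.  All spectral measures are absolutely continuous
    with respect to the image of Lebesgue measure under [f], so it remains to
    show that this image is singular and has no atoms.

    Singularity.  On a dyadic interval of length [2^-n] starting at [a] the
    function [f] varies by [O(2^-n (|S_n a| + n^(-1/2)))], where
    [S_n x = \sum_(l <= n) l^(-1/2) sin (2 pi 2^(l-1) x)] is its slope at scale
    [2^-n].  The weights are square-divergent but tend to 0: the variance of the
    [S_m] inside any dyadic interval is unbounded, so a proportion at least 1/24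
    of it lies in subintervals on which the slope has changed sign, and just
    before that change the slope was [O(n^(-1/2))].  Iterating, almost all of
    [[0, 1]] is covered by disjoint dyadic intervals [J] with
    [|f(J)| <= eps |J|].

    No atoms.  For [h = 2^-p] the difference [f(x + h) - f(x)] is a nonzero
    trigonometric polynomial, so a level set of [f] is almost disjoint from its
    small dyadic translates and hence null. *)

Require Import Defs.
From HB Require Import structures.
From mathcomp Require Import all_boot all_order all_algebra complex.
From mathcomp Require Import all_classical all_reals all_analysis.
From mathcomp Require Import measurable_realfun ring lra zify.

Set Implicit Arguments.
Unset Strict Implicit.
Unset Printing Implicit Defensive.

Import Order.TTheory GRing.Theory Num.Theory.
Import numFieldNormedType.Exports.

Local Open Scope classical_set_scope.
Local Open Scope ring_scope.

(** * Two-sided sums and real square-summable sequences *)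

Section TwoSidedSums.
Variable R : realType.
Implicit Types (a b g h : int -> R) (c : R).

Definition psum (N : nat) g : R := \sum_(0 <= j < N.*2.+1) g (j%:Z - N%:Z).

Lemma zsumE g : zsum g = limn (psum ^~ g).
Proof. by []. Qed.

Lemma cvg_zsum g l : psum N g @[N --> \oo] --> l -> zsum g = l.
Proof. by move=> gl; rewrite zsumE; exact: cvg_lim gl. Qed.

Lemma eq_psum N g h : g =1 h -> psum N g = psum N h.
Proof. by move=> gh; apply: eq_bigr => j _; rewrite gh. Qed.

Lemma psum0 g : psum 0 g = g 0.
Proof. by rewrite /psum big_nat1. Qed.

Lemma psumS N g : psum N.+1 g = psum N g + g N.+1%:Z + g (- N.+1%:Z).
Proof.
rewrite /psum doubleS big_nat_recl// big_nat_recr//= [LHS]addrC.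
congr (_ + _ + _); [apply: eq_bigr => j _| |]; congr g; lia.
Qed.

Lemma psumD N g h : psum N (fun n => g n + h n) = psum N g + psum N h.
Proof. by rewrite /psum big_split. Qed.

Lemma psumZ N c g : psum N (fun n => c * g n) = c * psum N g.
Proof. by rewrite /psum big_distrr. Qed.

Lemma psumB N g h : psum N (fun n => g n - h n) = psum N g - psum N h.
Proof. by rewrite /psum sumrB. Qed.

Lemma psum_ge0 N g : (forall n, 0 <= g n) -> 0 <= psum N g.
Proof. by move=> g0; apply: sumr_ge0. Qed.

Lemma ler_psum N g h : (forall n, g n <= h n) -> psum N g <= psum N h.
Proof. by move=> gh; apply: ler_sum. Qed.

Lemma psum_homo g : (forall n, 0 <= g n) ->
  {homo psum ^~ g : N M / (N <= M)%N >-> N <= M}.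
Proof.
move=> g0; apply/nondecreasing_seqP => n.
by rewrite psumS -addrA lerDl addr_ge0.
Qed.

Lemma psum_cvgn N (F : nat -> int -> R) (G : int -> R) :
  (forall n, F M n @[M --> \oo] --> G n) ->
  psum N (F M) @[M --> \oo] --> psum N G.
Proof. by move=> FG; apply: cvg_big => [|j _]; [exact: add_continuous|exact: FG]. Qed.

Lemma ge0_psum_cvg g C : (forall n, 0 <= g n) -> (forall N, psum N g <= C) ->
  psum N g @[N --> \oo] --> zsum g.
Proof.
move=> g0 gC; apply: nondecreasing_is_cvgn; first exact: psum_homo.
by exists C => _ [N _ <-].
Qed.

Lemma ge0_psum_le_zsum g C N : (forall n, 0 <= g n) ->
  (forall N, psum N g <= C) -> psum N g <= zsum g.
Proof.
move=> g0 gC; apply: nondecreasing_cvgn_le; first exact: psum_homo.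
exact: ge0_psum_cvg gC.
Qed.

Definition trunc N a (n : int) : R := if (`|n| <= N)%N then a n else 0.

Lemma psum_eq_small N g h : (forall n, (`|n| <= N)%N -> g n = h n) ->
  psum N g = psum N h.
Proof.
move=> gh; rewrite /psum !big_nat; apply: eq_bigr => j /andP[_ jN].
by apply: gh; lia.
Qed.

Lemma psum_trunc N M g : (N <= M)%N ->
  (forall n, (N < `|n|)%N -> g n = 0) -> psum M g = psum N g.
Proof.
elim: M => [|M IH]; first by rewrite leqn0 => /eqP ->.
rewrite leq_eqVlt => /predU1P[-> //|]; rewrite ltnS => NM g0.
by rewrite psumS IH// !g0 ?addr0//; lia.
Qed.

Lemma zsum_trunc N g : (forall n, (N < `|n|)%N -> g n = 0) -> zsum g = psum N g.
Proof.
move=> g0; apply: cvg_zsum; apply: cvg_near_cst.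
by exists N => // M /= NM; exact: psum_trunc.
Qed.

(** Bounded symmetric partial sums of squares converge by monotonicity; [ell2P] links this form to
    [ell2]. *)
Definition l2 a := exists C, forall N, psum N (fun n => a n ^+ 2) <= C.

Definition dot a b : R := zsum (fun n => a n * b n).

Lemma l2_sq_cvg a : l2 a ->
  psum N (fun n => a n ^+ 2) @[N --> \oo] --> dot a a.
Proof.
move=> [C aC]; rewrite /dot.
under [X in _ --> zsum X]funext do rewrite -expr2.
by apply: ge0_psum_cvg aC => n; exact: sqr_ge0.
Qed.

Lemma l2Z c a : l2 a -> l2 (fun n => c * a n).
Proof.
move=> [C aC]; exists (c ^+ 2 * C) => N.
under eq_psum do rewrite exprMn.
by rewrite psumZ ler_wpM2l ?sqr_ge0.
Qed.

Lemma l2D a b : l2 a -> l2 b -> l2 (fun n => a n + b n).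
Proof.
move=> [C aC] [D bD]; exists (2 * C + 2 * D) => N.
apply: le_trans (_ : psum N (fun n => 2 * a n ^+ 2 + 2 * b n ^+ 2) <= _).
  by apply: ler_psum => n; have := sqr_ge0 (a n - b n); nra.
by rewrite psumD !psumZ lerD// ler_wpM2l.
Qed.

Lemma l2B a b : l2 a -> l2 b -> l2 (fun n => a n - b n).
Proof.
move=> la lb; have := l2D la (l2Z (-1) lb).
by under [X in l2 X]funext do rewrite mulN1r.
Qed.

Lemma l2_eq0 N a : (forall n, (N < `|n|)%N -> a n = 0) -> l2 a.
Proof.
move=> a0; exists (psum N (fun n => a n ^+ 2)) => M.
have [MN|/ltnW NM] := leqP M N.
  by apply: psum_homo => // n; exact: sqr_ge0.
by rewrite (psum_trunc NM)// => n /a0 ->; rewrite expr0n.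
Qed.

Lemma trunc0 N a n : (N < `|n|)%N -> trunc N a n = 0.
Proof. by move=> Nn; rewrite /trunc leqNgt Nn. Qed.

Lemma l2_trunc N a : l2 (trunc N a).
Proof. by apply: (l2_eq0 (N := N)) => n; exact: trunc0. Qed.

(* Polarization: [4 a b = (a + b)^2 - (a - b)^2]. *)
Lemma dot_cvg a b : l2 a -> l2 b ->
  psum N (fun n => a n * b n) @[N --> \oo] --> dot a b.
Proof.
move=> la lb; apply: (@cvgP _ _ (4^-1 *
  (dot (fun n => a n + b n) (fun n => a n + b n)
   - dot (fun n => a n - b n) (fun n => a n - b n)))).
have -> : (fun N => psum N (fun n => a n * b n)) = (fun N =>
    4^-1 * (psum N (fun n => (a n + b n) ^+ 2)
            - psum N (fun n => (a n - b n) ^+ 2))).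
  apply/funext => N; rewrite -psumB -psumZ; apply: eq_psum => n.
  by field.
by apply: cvgMr; apply: cvgB; apply: l2_sq_cvg; [exact: l2D|exact: l2B].
Qed.

Lemma dotC a b : dot a b = dot b a.
Proof. by rewrite /dot; congr zsum; apply/funext => n; rewrite mulrC. Qed.

Lemma dotDr a b b' : l2 a -> l2 b -> l2 b' ->
  dot a (fun n => b n + b' n) = dot a b + dot a b'.
Proof.
move=> la lb lb'; apply: cvg_zsum.
under eq_fun do (under eq_psum do rewrite mulrDr; rewrite psumD).
by apply: cvgD; exact: dot_cvg.
Qed.

Lemma dotZr c a b : l2 a -> l2 b -> dot a (fun n => c * b n) = c * dot a b.
Proof.
move=> la lb; apply: cvg_zsum.
under eq_fun do (under eq_psum do rewrite mulrCA; rewrite psumZ).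
by apply: cvgMr; exact: dot_cvg.
Qed.

Lemma dotBr a b b' : l2 a -> l2 b -> l2 b' ->
  dot a (fun n => b n - b' n) = dot a b - dot a b'.
Proof.
move=> la lb lb'; rewrite -mulN1r -dotZr// -dotDr//; last exact: l2Z.
by under [in RHS]eq_fun do rewrite mulN1r.
Qed.

Lemma dotBl a a' b : l2 a -> l2 a' -> l2 b ->
  dot (fun n => a n - a' n) b = dot a b - dot a' b.
Proof. by move=> la la' lb; rewrite dotC dotBr// !(dotC b). Qed.

Lemma psum_le_dot a N : l2 a -> psum N (fun n => a n ^+ 2) <= dot a a.
Proof.
move=> [C aC]; rewrite /dot.
under [X in _ <= zsum X]eq_fun do rewrite -expr2.
by apply: ge0_psum_le_zsum aC => n; exact: sqr_ge0.
Qed.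

Lemma dot_ge0 a : l2 a -> 0 <= dot a a.
Proof.
move=> la; apply: le_trans (psum_le_dot 0 la).
by apply: psum_ge0 => n; exact: sqr_ge0.
Qed.

Lemma dot_le a C : l2 a -> (forall N, psum N (fun n => a n ^+ 2) <= C) ->
  dot a a <= C.
Proof.
move=> la aC; have := l2_sq_cvg la => /cvg_lim <- //.
apply: limr_le; first by apply: cvgP; exact: l2_sq_cvg.
by near=> N; exact: aC.
Unshelve. all: by end_near. Qed.

(** The common core of both Cauchy-Schwarz inequalities, [dot_CS] and [I01_CS]. For [C = 0] a
    nonzero [B] is refuted at [t = - (A + 1) / (2 B)]; otherwise [t = - B / C] is the minimum. *)
Lemma discriminant_le (A B C : R) : 0 <= C ->
  (forall t, 0 <= A + t * B *+ 2 + t ^+ 2 * C) -> B ^+ 2 <= A * C.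
Proof.
rewrite le_eqVlt => /predU1P[<- H|C0 H].
  have [->|B0] := eqVneq B 0; first by rewrite expr0n mulr0.
  have := H (- (A + 1) / (B *+ 2)).
  rewrite mulr0 addr0 -mulrnAr -mulrA mulVf; last by rewrite mulrn_eq0.
  lra.
have := H (- B / C); rewrite -(ler_pM2r C0) mul0r.
have -> : (A + - B / C * B *+ 2 + (- B / C) ^+ 2 * C) * C = A * C - B ^+ 2.
  by field; rewrite gt_eqF.
by rewrite subr_ge0.
Qed.

Lemma dot_CS a b : l2 a -> l2 b -> dot a b ^+ 2 <= dot a a * dot b b.
Proof.
move=> la lb; apply: discriminant_le; first exact: dot_ge0.
move=> t; set s := fun n => a n + t * b n.
have ltb := l2Z t lb; have ls : l2 s by exact: l2D.
have Ea : dot s a = dot a a + t * dot a b by rewrite dotC dotDr ?dotZr.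
have Eb : dot s b = dot a b + t * dot b b by rewrite dotC dotDr ?dotZr ?(dotC b a).
apply: le_trans (dot_ge0 ls) _; rewrite {2}/s dotDr// dotZr// Ea Eb.
by rewrite le_eqVlt; apply/orP; left; apply/eqP; ring.
Qed.

Definition nrm a := Num.sqrt (dot a a).

Lemma nrm_ge0 a : 0 <= nrm a. Proof. exact: sqrtr_ge0. Qed.

Lemma sqr_nrm a : l2 a -> nrm a ^+ 2 = dot a a.
Proof. by move=> la; rewrite sqr_sqrtr// dot_ge0. Qed.

Lemma ler_norm_dot a b : l2 a -> l2 b -> `|dot a b| <= nrm a * nrm b.
Proof.
move=> la lb; rewrite -ler_sqr ?nnegrE ?mulr_ge0 ?nrm_ge0//.
by rewrite real_normK ?num_real// exprMn !sqr_nrm// dot_CS.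
Qed.

Definition tail N a n := a n - trunc N a n.

Lemma l2_tail N a : l2 a -> l2 (tail N a).
Proof. by move=> la; apply: l2B => //; exact: l2_trunc. Qed.

Lemma dot_tail N a : l2 a ->
  dot (tail N a) (tail N a) = dot a a - psum N (fun n => a n ^+ 2).
Proof.
move=> la; have -> : dot (tail N a) (tail N a) = dot a a - dot a (trunc N a).
  rewrite -dotBr//; last exact: l2_trunc.
  rewrite /dot; congr zsum; apply/funext => n; rewrite /tail /trunc.
  by case: ifP => _; rewrite ?subrr ?mulr0 ?subr0.
congr (_ - _); rewrite /dot (zsum_trunc (N := N)).
  by apply: psum_eq_small => n nN; rewrite /trunc nN.
by move=> n /trunc0 ->; rewrite mulr0.
Qed.

Lemma nrm_tail_cvg a : l2 a -> nrm (tail N a) @[N --> \oo] --> (0 : R).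
Proof.
move=> la; rewrite -(sqrtr0 R) /nrm.
have : dot (tail N a) (tail N a) @[N --> \oo] --> (0 : R).
  under eq_fun do rewrite dot_tail//.
  rewrite -(subrr (dot a a)); apply: cvgB; first exact: cvg_cst.
  exact: l2_sq_cvg.
by apply: continuous_cvg; exact: sqrt_continuous.
Qed.

Lemma nrm_trunc N a : l2 a -> nrm (trunc N a) <= nrm a.
Proof.
move=> la; apply: ler_wsqrtr; apply: dot_le; first exact: l2_trunc.
move=> M; apply: le_trans (psum_le_dot M la); apply: ler_psum => n.
by rewrite /trunc; case: ifP => // _; rewrite expr0n sqr_ge0.
Qed.

(** Decay at both ends allows moving the centre of a symmetric partial sum, which only exchanges
    boundary terms. *)
Definition vanishing g := forall e : R, 0 < e ->
  exists N, forall n, (N < `|n|)%N -> `|g n| <= e.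

Lemma vanishing_shift g m : vanishing g -> vanishing (fun n => g (n + m)).
Proof.
move=> vg e e0; have [N gN] := vg e e0; exists (N + `|m|)%N => n Nn.
by apply: gN; lia.
Qed.

Lemma l2_vanishing a : l2 a -> vanishing a.
Proof.
move=> la e e0; have e20 : 0 < e ^+ 2 by rewrite exprn_gt0.
have := l2_sq_cvg la => /cvgrPdist_le/(_ _ e20)[N _ HN].
exists N => n Nn; pose s N := psum N (fun n => a n ^+ 2).
(* The difference of the partial sums at [|n|] and [|n| - 1] contains [a n ^+ 2] and is at most the
   remainder of the series. *)
have : s `|n|%N - s `|n|.-1%N <= e ^+ 2.
  have := HN `|n|.-1%N; rewrite /= ler_norml => /(_ ltac:(lia))/andP[_].
  by apply: le_trans; rewrite lerD2r; exact: psum_le_dot.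
move=> H; rewrite -ler_sqr ?nnegrE ?(ltW e0)// real_normK ?num_real//.
apply: le_trans H; rewrite -[in s `|n|%N](@prednK `|n|%N); last by lia.
rewrite /s psumS prednK; last by lia.
have := sqr_ge0 (a `|n|%N); have := sqr_ge0 (a (- `|n|%N%:Z)).
have [->|->] : n = `|n|%N%:Z \/ n = - `|n|%N%:Z by lia.
  by rewrite absz_nat; lra.
by rewrite abszN absz_nat; lra.
Qed.

Lemma vanishingM a b : vanishing a -> vanishing b ->
  vanishing (fun n => a n * b n).
Proof.
move=> va vb e e0.
have [N aN] := va 1 ltr01; have [M bM] := vb e e0.
exists (maxn N M) => n; rewrite gtn_max => /andP[Nn Mn].
by rewrite normrM -[e]mul1r ler_pM// ?aN ?bM.
Qed.

Lemma psum_shift1_cvg g (l : R) : vanishing g ->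
  (psum N g @[N --> \oo] --> l) <->
  (psum N (fun n => g (n + 1)) @[N --> \oo] --> l).
Proof.
move=> vg; pose d N := g N.+1%:Z - g (- N%:Z).
have E N : psum N (fun n => g (n + 1)) = psum N g + d N.
  rewrite /d; elim: N => [|N IH].
    by rewrite !psum0 add0r oppr0; ring.
  rewrite !psumS IH.
  have -> : N.+1%:Z + 1 = N.+2%:Z by lia.
  have -> : - N.+1%:Z + 1 = - N%:Z by lia.
  ring.
have d0 : d N @[N --> \oo] --> (0 : R).
  apply/cvgr0Pnorm_le => e e0.
  have e20 : 0 < e / 2 by rewrite divr_gt0.
  have [N gN] := vg _ e20; exists N.+1 => // n /= Nn.
  apply: le_trans (ler_normB _ _) _; rewrite [e]splitr.
  by apply: lerD; apply: gN; lia.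
have E' N : psum N g = psum N (fun n => g (n + 1)) - d N by rewrite E addrK.
split=> H.
  by under eq_fun do rewrite E; rewrite -[l]addr0; exact: cvgD.
by under eq_fun do rewrite E'; rewrite -[l]subr0; exact: cvgB.
Qed.

Lemma psum_shiftn_cvg g (m : nat) (l : R) : vanishing g ->
  (psum N g @[N --> \oo] --> l) <->
  (psum N (fun n => g (n + m%:Z)) @[N --> \oo] --> l).
Proof.
elim: m g => [|m IH] g g0.
  by rewrite (_ : (fun n => g (n + 0%:Z)) = g)//; apply/funext => n; rewrite addr0.
rewrite psum_shift1_cvg// IH; last exact: vanishing_shift.
suff -> : (fun n => g (n + m%:Z + 1)) = (fun n => g (n + m.+1%:Z)) by [].
by apply/funext => n; congr g; lia.
Qed.

Lemma psum_shift_cvg g (m : int) (l : R) : vanishing g ->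
  (psum N g @[N --> \oo] --> l) ->
  (psum N (fun n => g (n + m)) @[N --> \oo] --> l).
Proof.
case: m => m vg; first by move/(psum_shiftn_cvg m l vg).
(* A negative shift is undone by a positive one, so the equivalence is read backwards. *)
move=> gl; apply/(psum_shiftn_cvg m.+1); first exact: vanishing_shift.
suff -> : (fun n => g (n + m.+1%:Z + Negz m)) = g by [].
by apply/funext => n; congr g; lia.
Qed.

End TwoSidedSums.

(** * Bounded measurable functions on [0, 1] *)

Section BoundedMeasurable.
Variable R : realType.
Implicit Types (u v g h : R -> R) (c : R).
Local Notation leb := (@lebesgue_measure R).

Definition bm g := measurable_fun [set: R] g /\ exists M, forall x, `|g x| <= M.

Definition I01 g : R := \int[leb]_(x in `[0, 1]) g x.

Lemma leb01 : leb `[0%R, 1%R] = 1%E.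
Proof. by rewrite lebesgue_measure_itv/= lte01 sube0. Qed.

Lemma bm_integrable g : bm g -> leb.-integrable `[0, 1] (EFin \o g).
Proof.
move=> [mg [M gM]]; apply: measurable_bounded_integrable => //=.
- by rewrite leb01 ltry.
- exact: measurable_funS mg.
- exists M; split; first exact: num_real.
  by move=> x Mx t _ /=; apply: le_trans (gM t) (ltW Mx).
Qed.

Lemma bm_cst c : bm (fun=> c).
Proof. by split; [exact: measurable_cst|exists `|c|]. Qed.

Lemma bmD g h : bm g -> bm h -> bm (fun x => g x + h x).
Proof.
move=> [mg [M gM]] [mh [N hN]]; split; first exact: measurable_funD.
by exists (M + N) => x; apply: le_trans (ler_normD _ _) _; exact: lerD.
Qed.

Lemma bmM g h : bm g -> bm h -> bm (fun x => g x * h x).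
Proof.
move=> [mg [M gM]] [mh [N hN]]; split; first exact: measurable_funM.
by exists (M * N) => x; rewrite normrM ler_pM.
Qed.

Lemma bmZ c g : bm g -> bm (fun x => c * g x).
Proof. by move=> bg; apply: bmM => //; exact: bm_cst. Qed.

Lemma bmB g h : bm g -> bm h -> bm (fun x => g x - h x).
Proof.
move=> bg bh; have := bmD bg (bmZ (-1) bh).
by under [X in bm X]eq_fun do rewrite mulN1r.
Qed.

Lemma bmX g n : bm g -> bm (fun x => g x ^+ n).
Proof.
move=> bg; elim: n => [|n IH]; first exact: bm_cst.
by under eq_fun do rewrite exprS; exact: bmM.
Qed.

Lemma bm_sum (r : seq nat) (F : nat -> R -> R) : (forall i, bm (F i)) ->
  bm (fun x => \sum_(i <- r) F i x).
Proof.
move=> bF; elim: r => [|i r IH].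
  by under eq_fun do rewrite big_nil; exact: bm_cst.
by under eq_fun do rewrite big_cons; exact: bmD.
Qed.

Lemma bm_psum N (F : int -> R -> R) : (forall n, bm (F n)) ->
  bm (fun x => psum N (F ^~ x)).
Proof. by move=> bF; apply: bm_sum. Qed.

Lemma I01D g h : bm g -> bm h -> I01 (fun x => g x + h x) = I01 g + I01 h.
Proof. by move=> bg bh; rewrite /I01 RintegralD//; exact: bm_integrable. Qed.

Lemma I01B g h : bm g -> bm h -> I01 (fun x => g x - h x) = I01 g - I01 h.
Proof. by move=> bg bh; rewrite /I01 RintegralB//; exact: bm_integrable. Qed.

Lemma I01Z c g : bm g -> I01 (fun x => c * g x) = c * I01 g.
Proof. by move=> bg; rewrite /I01 RintegralZl//; exact: bm_integrable. Qed.

Lemma I01_cst c : I01 (fun=> c) = c.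
Proof.
rewrite /I01 Rintegral_cst// -[RHS]mulr1; congr (_ * _).
by rewrite [X in fine X]leb01.
Qed.

Lemma I01_sum (r : seq nat) (F : nat -> R -> R) : (forall i, bm (F i)) ->
  I01 (fun x => \sum_(i <- r) F i x) = \sum_(i <- r) I01 (F i).
Proof.
move=> bF; elim: r => [|i r IH].
  by rewrite big_nil; under eq_fun do rewrite big_nil; exact: I01_cst.
rewrite big_cons -IH -I01D//; last exact: bm_sum.
by congr I01; apply/funext => x; rewrite big_cons.
Qed.

Lemma I01_psum N (F : int -> R -> R) : (forall n, bm (F n)) ->
  I01 (fun x => psum N (F ^~ x)) = psum N (fun n => I01 (F n)).
Proof. by move=> bF; apply: I01_sum. Qed.

Lemma I01_le g h : bm g -> bm h -> (forall x, 0 <= x <= 1 -> g x <= h x) ->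
  I01 g <= I01 h.
Proof.
move=> bg bh gh; apply: le_Rintegral; [by []|exact: bm_integrable|exact: bm_integrable|].
by move=> x /=; rewrite in_itv/=; exact: gh.
Qed.

Lemma I01_ge0 g : (forall x, 0 <= g x) -> 0 <= I01 g.
Proof. by move=> g0; apply: Rintegral_ge0. Qed.

Lemma I01_ae0 g (N : set R) : bm g -> measurable N -> leb N = 0%E ->
  (forall x, 0 <= x <= 1 -> ~ N x -> g x = 0) -> I01 g = 0.
Proof.
move=> bg mN N0 gN; rewrite /I01 /Rintegral.
rewrite (@negligible_integral _ _ _ leb _ N)//; last exact: bm_integrable.
rewrite integral0_eq// => x [/=]; rewrite in_itv/= => x01 Nx.
by rewrite gN.
Qed.

Lemma I01_CS g h : bm g -> bm h ->
  I01 (fun x => g x * h x) ^+ 2 <= I01 (fun x => g x ^+ 2) * I01 (fun x => h x ^+ 2).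
Proof.
move=> bg bh; apply: discriminant_le.
  by apply: I01_ge0 => x; exact: sqr_ge0.
move=> t; have : 0 <= I01 (fun x => (g x + t * h x) ^+ 2).
  by apply: I01_ge0 => x; exact: sqr_ge0.
congr (_ <= _).
have -> : (fun x => (g x + t * h x) ^+ 2) = (fun x =>
    (g x ^+ 2 + (t *+ 2) * (g x * h x)) + t ^+ 2 * h x ^+ 2).
  by apply/funext => x; ring.
have b1 := bmX 2 bg; have b2 := bmX 2 bh; have b3 := bmM bg bh.
rewrite I01D//; [|by apply: bmD => //; exact: bmZ|exact: bmZ].
by rewrite I01D ?I01Z//; [ring|exact: bmZ].
Qed.

Lemma I01_cvg (g_ : nat -> R -> R) (g : R -> R) (M : R) :
  (forall n, bm (g_ n)) -> bm g ->
  (forall n x, 0 <= x <= 1 -> `|g_ n x| <= M) ->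
  (forall x, 0 <= x <= 1 -> g_ n x @[n --> \oo] --> g x) ->
  I01 (g_ n) @[n --> \oo] --> I01 g.
Proof.
move=> bg_ bg gM gg; rewrite /I01 /Rintegral.
pose D : set (measurableTypeR R) := `[0, 1]%classic.
have mD : measurable D by exact: measurable_itv.
have mgn n : measurable_fun D (fun x => (g_ n x)%:E).
  by apply/measurable_EFinP; exact: measurable_funS (bg_ n).1.
have mg : measurable_fun D (fun x => (g x)%:E).
  by apply/measurable_EFinP; exact: measurable_funS bg.1.
apply: fine_cvg; rewrite fineK; last first.
  by apply: integrable_fin_num => //; exact: bm_integrable.
have [|||_ _ //] := @dominated_convergence _ _ R leb D mD
  (fun n x => (g_ n x)%:E) (fun x => (g x)%:E) (cst M%:E) mgn mg.
- apply: aeW => x; rewrite /D/= in_itv/= => x01.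
  by apply: cvg_EFin; [exact: nearW|exact: gg].
- exact: bm_integrable (bm_cst M).
- by apply: aeW => x n; rewrite /D/= in_itv/= => x01; rewrite lee_fin gM.
Qed.

End BoundedMeasurable.

(** * Operators with a symbol in an orthonormal family *)

Section OrthonormalFamily.
Variable R : realType.
Variable e : int -> R -> R.
Hypothesis bm_e : forall n, bm (e n).
Hypothesis e_orth : forall n m, I01 (fun x => e n x * e m x) = (n == m)%:R.
Implicit Types (a b : int -> R) (u v g h : R -> R).

Lemma psum_delta N (F : int -> R) m :
  psum N (fun n => F n * (n == m)%:R) = trunc N F m.
Proof.
elim: N => [|N IH].
  by rewrite psum0 /trunc leqn0 absz_eq0 eq_sym; case: eqP => [->|_];
     rewrite ?mulr1 ?mulr0.
rewrite psumS IH /trunc.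
have Nx : (N.+1%:Z == - N.+1%:Z) = false by lia.
have [->|mN] := altP (m =P N.+1%:Z).
  by rewrite ltnn leqnn eqxx eq_sym Nx mulr1 mulr0 addr0 add0r.
have [->|mN'] := altP (m =P - N.+1%:Z).
  by rewrite abszN ltnn leqnn eqxx Nx mulr1 mulr0 addr0 add0r.
rewrite !(eq_sym _ m) (negPf mN) (negPf mN') !mulr0 !addr0.
by congr (if _ then _ else _); lia.
Qed.

Definition coef g n : R := I01 (fun x => g x * e n x).
Definition synth N a x : R := psum N (fun n => a n * e n x).

Lemma bm_synth N a : bm (synth N a).
Proof. by apply: (bm_psum N (F := fun n x => a n * e n x)) => n; exact: bmZ. Qed.

Lemma I01_synthM N a g : bm g ->
  I01 (fun x => synth N a x * g x) = psum N (fun n => a n * coef g n).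
Proof.
move=> bg; pose F n x := a n * (g x * e n x).
have -> : (fun x => synth N a x * g x) = (fun x => psum N (F ^~ x)).
  apply/funext => x; rewrite mulrC -psumZ; apply: eq_psum => n.
  by rewrite /F mulrCA.
rewrite I01_psum; last by move=> n; apply: bmZ; exact: bmM.
by apply: eq_psum => n; rewrite I01Z//; exact: bmM.
Qed.

Lemma coef_e n m : coef (e n) m = (n == m)%:R.
Proof. exact: e_orth. Qed.

Lemma coef_synth N a m : coef (synth N a) m = trunc N a m.
Proof.
rewrite /coef I01_synthM// -psum_delta.
by apply: eq_psum => n; rewrite coef_e eq_sym.
Qed.

Lemma I01_synth_synth N a b :
  I01 (fun x => synth N a x * synth N b x) = psum N (fun n => a n * b n).
Proof.
rewrite I01_synthM; last exact: bm_synth.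
by apply: psum_eq_small => n nN; rewrite coef_synth /trunc nN.
Qed.

(** Completing the square coefficient by coefficient. With [a = coef g] this gives Bessel's
    inequality, and for general [a] the optimality of the Fourier coefficients used in
    [parseval]. *)
Lemma synth_dist2 N a g : bm g ->
  I01 (fun x => (g x - synth N a x) ^+ 2) =
  I01 (fun x => g x ^+ 2) - psum N (fun n => coef g n ^+ 2)
  + psum N (fun n => (a n - coef g n) ^+ 2).
Proof.
move=> bg; have bs := bm_synth N a.
have -> : (fun x => (g x - synth N a x) ^+ 2) = (fun x =>
    (g x ^+ 2 - 2 * (synth N a x * g x)) + synth N a x * synth N a x).
  by apply/funext => x; ring.
have b1 := bmX 2 bg; have b2 := bmM bs bg; have b3 := bmM bs bs.
rewrite I01D//; last by apply: bmB => //; exact: bmZ.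
rewrite I01B//; last exact: bmZ.
rewrite I01Z// I01_synth_synth I01_synthM//.
have -> : psum N (fun n => (a n - coef g n) ^+ 2) = psum N (fun n => coef g n ^+ 2)
    - 2 * psum N (fun n => a n * coef g n) + psum N (fun n => a n * a n).
  by rewrite -psumZ -psumB -psumD; apply: eq_psum => n; ring.
by ring.
Qed.

Lemma bessel N g : bm g -> psum N (fun n => coef g n ^+ 2) <= I01 (fun x => g x ^+ 2).
Proof.
move=> bg; rewrite -subr_ge0.
have := synth_dist2 N (coef g) bg.
have -> : psum N (fun n => (coef g n - coef g n) ^+ 2) = 0.
  by apply: big1 => j _; rewrite subrr expr0n.
by rewrite addr0 => <-; apply: I01_ge0 => x; exact: sqr_ge0.
Qed.

Lemma l2_coef g : bm g -> l2 (coef g).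
Proof. by move=> bg; exists (I01 (fun x => g x ^+ 2)) => N; exact: bessel. Qed.

(** Membership in the closed linear span of [e] in L^2(0, 1). *)
Definition approximable g := forall eps, 0 < eps ->
  exists N a, I01 (fun x => (g x - synth N a x) ^+ 2) <= eps.

Lemma synth_trunc N M a : (N <= M)%N -> synth M (trunc N a) = synth N a.
Proof.
move=> NM; apply/funext => x; rewrite /synth (psum_trunc NM).
  by apply: psum_eq_small => n nN; rewrite /trunc nN.
by move=> n nN; rewrite trunc0// mul0r.
Qed.

(** For [g] in the closed span the Fourier remainder [r N] tends to 0 in L^2, since it beats every
    approximation with fewer terms; Cauchy-Schwarz against [h] does the rest. *)
Lemma parseval g h : bm g -> bm h -> approximable g ->
  dot (coef g) (coef h) = I01 (fun x => g x * h x).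
Proof.
move=> bg bh ag; apply: cvg_zsum.
pose r N x := g x - synth N (coef g) x.
have br N : bm (r N) by apply: bmB => //; exact: bm_synth.
have rE N : psum N (fun n => coef g n * coef h n) =
    I01 (fun x => g x * h x) - I01 (fun x => r N x * h x).
  rewrite -I01_synthM// -I01B; [|exact: bmM|exact: bmM].
  by congr I01; apply/funext => x; rewrite /r; ring.
under eq_fun do rewrite rE.
suff r0 : I01 (fun x => r N x * h x) @[N --> \oo] --> (0 : R).
  rewrite -[X in nbhs X]subr0; apply: cvgB => //; exact: cvg_cst.
apply/cvgr0Pnorm_le => d d0.
set H := I01 (fun x => h x ^+ 2).
have H0 : 0 <= H by apply: I01_ge0 => x; exact: sqr_ge0.
have eps0 : 0 < d ^+ 2 / (H + 1) by rewrite divr_gt0 ?exprn_gt0// ltr_wpDl.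
have [N [a Na]] := ag _ eps0; exists N => // M /= NM.
rewrite -ler_sqr ?nnegrE ?(ltW d0)// real_normK ?num_real//.
apply: le_trans (I01_CS (br M) bh) _; rewrite -/H.
have rM : I01 (fun x => r M x ^+ 2) <= d ^+ 2 / (H + 1).
  apply: le_trans Na; rewrite -(synth_trunc a NM) !synth_dist2//.
  rewrite lerD2l.
  have -> : psum M (fun n => (coef g n - coef g n) ^+ 2) = 0.
    by apply: big1 => j _; rewrite subrr expr0n.
  by apply: psum_ge0 => n; exact: sqr_ge0.
apply: le_trans (ler_wpM2r H0 rM) _.
rewrite mulrAC ler_pdivrMr; last by rewrite ltr_wpDl.
by rewrite ler_wpM2l ?sqr_ge0// lerDl.
Qed.

Definition kernel u n m : R := I01 (fun x => u x * e n x * e m x).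

(** The matrix of multiplication by [u] in the family [e], applied to [a]. By Bessel its rows are
    square-summable when [u] is bounded and measurable, so the series converges for [a] in [l2]. *)
Definition oper u a n : R := zsum (fun m => kernel u n m * a m).

Lemma operE u a n : oper u a n = dot (kernel u n) a.
Proof. by []. Qed.

Lemma kernelC u n m : kernel u n m = kernel u m n.
Proof. by congr I01; apply/funext => x; rewrite mulrAC. Qed.

Lemma kernel_coef u n : kernel u n = coef (fun x => u x * e n x).
Proof. by []. Qed.

Lemma l2_kernel u n : bm u -> l2 (kernel u n).
Proof. by move=> bu; apply: l2_coef; exact: bmM. Qed.

Lemma oper_trunc N u a n : bm u ->
  oper u (trunc N a) n = coef (fun x => u x * synth N a x) n.
Proof.
move=> bu; rewrite /oper (zsum_trunc (N := N)); last first.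
  by move=> m mN; rewrite trunc0// mulr0.
have bue : bm (fun x => u x * e n x) by exact: bmM.
transitivity (psum N (fun m => a m * coef (fun x => u x * e n x) m)).
  by apply: psum_eq_small => m mN; rewrite /trunc mN mulrC.
rewrite -I01_synthM//; congr I01; apply/funext => x; ring.
Qed.

Section Bounded.
Variables (u : R -> R) (M : R).
Hypotheses (bu : bm u) (uM : forall x, 0 <= x <= 1 -> `|u x| <= M).

Let M0 : 0 <= M.
Proof. by apply: le_trans (uM (x := 0) _); rewrite ?normr_ge0// lexx ler01. Qed.

Lemma oper_trunc_cvg a n : l2 a ->
  oper u (trunc N a) n @[N --> \oo] --> oper u a n.
Proof.
move=> la; have -> : (fun N => oper u (trunc N a) n) =
    (fun N => psum N (fun m => kernel u n m * a m)).
  apply/funext => N; rewrite /oper (zsum_trunc (N := N)).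
    by apply: psum_eq_small => m mN; rewrite /trunc mN.
  by move=> m mN; rewrite trunc0// mulr0.
by apply: dot_cvg => //; exact: l2_kernel.
Qed.

(** On a truncated sequence [oper] gives the Fourier coefficients of [u * synth K a], and Bessel
    yields the bound; then [K] tends to infinity while [N] stays fixed. *)
Lemma oper_bound N a : l2 a -> psum N (fun n => oper u a n ^+ 2) <= M ^+ 2 * dot a a.
Proof.
move=> la.
have H : psum N (fun n => oper u (trunc K a) n ^+ 2) @[K --> \oo]
    --> psum N (fun n => oper u a n ^+ 2).
  apply: (psum_cvgn (F := fun K n => oper u (trunc K a) n ^+ 2)) => n.
  by rewrite expr2; apply: cvgM; exact: oper_trunc_cvg.
apply: (cvgr_to_le H); near=> K.
have bs := bm_synth K a; have bus := bmM bu bs.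
under eq_psum do rewrite oper_trunc//.
apply: le_trans (bessel _ bus) _.
apply: le_trans (_ : I01 (fun x => M ^+ 2 * (synth K a x * synth K a x)) <= _).
  apply: I01_le; [exact: bmX|by apply: bmZ; exact: bmM|] => x x01.
  rewrite exprMn -expr2 ler_wpM2r ?sqr_ge0// -real_normK ?num_real//.
  by rewrite ler_sqr ?nnegrE// uM.
rewrite I01Z; last exact: bmM.
rewrite I01_synth_synth ler_wpM2l ?sqr_ge0//.
by under eq_psum do rewrite -expr2; exact: psum_le_dot.
Unshelve. all: by end_near. Qed.

Lemma l2_oper a : l2 a -> l2 (oper u a).
Proof. by move=> la; exists (M ^+ 2 * dot a a) => N; exact: oper_bound. Qed.

Lemma nrm_oper a : l2 a -> nrm (oper u a) <= M * nrm a.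
Proof.
move=> la; rewrite -ler_sqr ?nnegrE ?nrm_ge0 ?mulr_ge0 ?nrm_ge0//.
rewrite exprMn !sqr_nrm//; last exact: l2_oper.
by apply: dot_le; [exact: l2_oper|move=> N; exact: oper_bound].
Qed.

Lemma operB a b : l2 a -> l2 b ->
  oper u (fun n => a n - b n) = fun n => oper u a n - oper u b n.
Proof.
move=> la lb; apply/funext => n.
by rewrite !operE dotBr//; exact: l2_kernel.
Qed.

Lemma oper_linear c a b : l2 a -> l2 b ->
  oper u (fun n => c * a n + b n) = fun n => c * oper u a n + oper u b n.
Proof.
move=> la lb; have lK n := l2_kernel n bu; apply/funext => n.
by rewrite !operE dotDr// ?dotZr//; exact: l2Z.
Qed.

Definition qform N a b := I01 (fun x => u x * (synth N a x * synth N b x)).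

(** Only the bound [M] of [u] enters the error, so the approximation by finite sums is uniform over
    symbols with a common bound; [form_cvg] relies on this. *)
Lemma form_bound N a b : l2 a -> l2 b ->
  `|dot a (oper u b) - qform N a b|
  <= M * (nrm (tail N a) * nrm b + nrm a * nrm (tail N b)).
Proof.
move=> la lb.
have lTb := l2_oper lb; have lta := l2_trunc N a; have ltb := l2_trunc N b.
have lta' := l2_tail N la; have ltb' := l2_tail N lb.
have -> : qform N a b = dot (trunc N a) (oper u (trunc N b)).
  rewrite /dot (zsum_trunc (N := N)); last first.
    by move=> n nN; rewrite trunc0// mul0r.
  have bs := bmM bu (bm_synth N b).
  transitivity (psum N (fun n => a n * coef (fun x => u x * synth N b x) n)).
    by rewrite -I01_synthM//; congr I01; apply/funext => x; ring.
  by apply: psum_eq_small => n nN; rewrite oper_trunc// /trunc nN.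
have -> : dot a (oper u b) - dot (trunc N a) (oper u (trunc N b)) =
    dot (tail N a) (oper u b) + dot (trunc N a) (oper u (tail N b)).
  rewrite /tail operB// dotBl// dotBr//; last exact: l2_oper.
  by rewrite addrA subrK.
apply: le_trans (ler_normD _ _) _; rewrite mulrDr; apply: lerD.
  apply: le_trans (ler_norm_dot lta' lTb) _.
  by rewrite mulrCA ler_wpM2l ?nrm_ge0// nrm_oper.
apply: le_trans (ler_norm_dot lta (l2_oper ltb')) _.
rewrite mulrCA; apply: ler_pM; [exact: nrm_ge0|exact: nrm_ge0|exact: nrm_trunc|].
exact: nrm_oper.
Qed.

Lemma qform_cvg a b : l2 a -> l2 b ->
  qform N a b @[N --> \oo] --> dot a (oper u b).
Proof.
move=> la lb; pose d N := M * (nrm (tail N a) * nrm b + nrm a * nrm (tail N b)).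
have d0 : d N @[N --> \oo] --> (0 : R).
  have -> : 0 = M * (0 * nrm b + nrm a * 0) :> R by rewrite mul0r mulr0 addr0 mulr0.
  apply: cvgM; first exact: cvg_cst.
  by apply: cvgD; apply: cvgM; (exact: cvg_cst || exact: nrm_tail_cvg).
apply/cvgrPdist_le => r r0.
move/cvgr0Pnorm_le/(_ _ r0): d0; apply: filterS => N dN.
by apply: le_trans (form_bound N la lb) _; apply: le_trans dN; exact: ler_norm.
Qed.

(** Instead of exchanging a double series, both sides are seen as limits of [qform], which is
    symmetric in [a] and [b]. *)
Lemma oper_sym a b : l2 a -> l2 b -> dot a (oper u b) = dot (oper u a) b.
Proof.
move=> la lb; rewrite [RHS]dotC.
apply: (cvg_unique _ (qform_cvg la lb)) => //.
rewrite (_ : (fun N => qform N a b) = (fun N => qform N b a)).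
  exact: qform_cvg.
by apply/funext => N; rewrite /qform; congr I01; apply/funext => x; ring.
Qed.

Lemma form_ge0 a : l2 a -> (forall x, 0 <= u x) -> 0 <= dot a (oper u a).
Proof.
move=> la u0; apply: (cvgr_to_ge (qform_cvg la la)); apply: nearW => N.
by apply: I01_ge0 => x; rewrite mulr_ge0// -expr2 sqr_ge0.
Qed.

End Bounded.

Lemma bm_bound u : bm u -> exists M, forall x : R, 0 <= x <= 1 -> `|u x| <= M.
Proof. by move=> [_ [M uM]]; exists M. Qed.

Lemma bm_kernel u n m : bm u -> bm (fun x => u x * e n x * e m x).
Proof. by move=> bu; apply: bmM => //; exact: bmM. Qed.

Lemma kernelD u v n m : bm u -> bm v ->
  kernel (fun x => u x + v x) n m = kernel u n m + kernel v n m.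
Proof.
move=> bu bv; rewrite /kernel -I01D; [|exact: bm_kernel|exact: bm_kernel].
by congr I01; apply/funext => x; ring.
Qed.

Lemma kernelZ c u n m : bm u -> kernel (fun x => c * u x) n m = c * kernel u n m.
Proof.
move=> bu; rewrite /kernel -I01Z; last exact: bm_kernel.
by congr I01; apply/funext => x; ring.
Qed.

Lemma operDs u v a : bm u -> bm v -> l2 a ->
  oper (fun x => u x + v x) a = fun n => oper u a n + oper v a n.
Proof.
move=> bu bv la; apply/funext => n; rewrite !operE ![dot _ a]dotC.
have -> : kernel (fun x => u x + v x) n = fun m => kernel u n m + kernel v n m.
  by apply/funext => m; rewrite kernelD.
by rewrite dotDr//; exact: l2_kernel.
Qed.

Lemma operZs c u a : bm u -> l2 a ->
  oper (fun x => c * u x) a = fun n => c * oper u a n.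
Proof.
move=> bu la; apply/funext => n; rewrite !operE ![dot _ a]dotC.
have -> : kernel (fun x => c * u x) n = fun m => c * kernel u n m.
  by apply/funext => m; rewrite kernelZ.
by rewrite dotZr//; exact: l2_kernel.
Qed.

Lemma oper_cst c a : l2 a -> oper (fun=> c) a = fun n => c * a n.
Proof.
move=> la; apply/funext => n; apply: cvg_zsum; apply: cvg_near_cst.
exists `|n|%N => // N /= nN.
transitivity (c * psum N (fun m => a m * (m == n)%:R)).
  rewrite -psumZ; apply: eq_psum => m; rewrite /kernel.
  under eq_fun do rewrite -mulrA.
  by rewrite I01Z ?e_orth; [rewrite (eq_sym n); ring|exact: bmM].
by rewrite psum_delta /trunc nN.
Qed.

Lemma form_cvg (u_ : nat -> R -> R) u M a : (forall n, bm (u_ n)) -> bm u ->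
  (forall n (x : R), 0 <= x <= 1 -> `|u_ n x| <= M) ->
  (forall x : R, 0 <= x <= 1 -> u_ n x @[n --> \oo] --> u x) -> l2 a ->
  dot a (oper (u_ n) a) @[n --> \oo] --> dot a (oper u a).
Proof.
move=> bu_ bu uM uu la.
have uM' (x : R) : 0 <= x <= 1 -> `|u x| <= M.
  move=> x01; apply: (cvgr_to_le (cvg_norm (uu x x01))).
  by apply: nearW => n; exact: uM.
pose d N := M * (nrm (tail N a) * nrm a + nrm a * nrm (tail N a)).
have d0 : d N @[N --> \oo] --> (0 : R).
  have -> : 0 = M * (0 * nrm a + nrm a * 0) :> R by rewrite mul0r mulr0 addr0 mulr0.
  apply: cvgM; first exact: cvg_cst.
  by apply: cvgD; apply: cvgM; (exact: cvg_cst || exact: nrm_tail_cvg).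
apply/cvgrPdist_le => eps eps0; have e3 : 0 < eps / 3 by rewrite divr_gt0.
(* From here [N] is fixed: the error [d N] is the same for all [u_ n], and dominated convergence
   handles the finite sum. *)
move/cvgr0Pnorm_le/(_ _ e3): d0 => [N _ /(_ N (leqnn N)) dN].
have {}dN : d N <= eps / 3 by apply: le_trans dN; exact: ler_norm.
have bs := bm_synth N a; have bss := bmM bs bs; have [_ [K sK]] := bss.
have q : qform (u_ n) N a a @[n --> \oo] --> qform u N a a.
  apply: (I01_cvg (M := M * K)) => [n||n x x01|x x01].
  - exact: bmM.
  - exact: bmM.
  - by rewrite normrM ler_pM// uM.
  - by apply: cvgM; [exact: uu|exact: cvg_cst].
move/cvgrPdist_le/(_ _ e3): q; apply: filterS => n.
have := form_bound bu uM' N la la; have := form_bound (bu_ n) (uM n) N la la.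
rewrite -/(d N).
set A := dot a (oper (u_ n) a); set B := dot a (oper u a).
set C := qform (u_ n) N a a; set D := qform u N a a.
rewrite !ler_norml; lra.
Qed.

End OrthonormalFamily.

(** * Multipliers of the closed span *)

Section StepApproximation.
Variable R : realType.
Implicit Types x y r s : R.

(** The right side is [1 - s] times a geometric sum of [n + 1] terms, each at least [s ^+ n]. *)
Lemma mulrn_expr_le s n : 0 <= s <= 1 -> (1 - s) * (n.+1%:R * s ^+ n) <= 1 - s ^+ n.+1.
Proof.
move=> /andP[s0 s1]; elim: n => [|n IH]; first by rewrite expr0 expr1 !mulr1.
have sn0 : 0 <= s ^+ n.+1 by rewrite exprn_ge0.
have sn1 : s ^+ n.+1 <= 1 by rewrite exprn_ile1.
have {IH}:= ler_wpM2l s0 IH; rewrite -(natr1 n.+1) !exprS in sn0 sn1 *.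
set t := s ^+ n in sn0 sn1 *; set m : R := n.+1%:R; nra.
Qed.

(** With [r = s * s], one factor [s ^+ n] absorbs [n + 1] up to the constant [(1 - s)^-1], and the
    other decays geometrically. *)
Lemma mulrn_expr_cvg0 r : 0 <= r < 1 -> n.+1%:R * r ^+ n @[n --> \oo] --> (0 : R).
Proof.
move=> /andP[r0 r1]; set s := Num.sqrt r.
have s0 : 0 <= s by exact: sqrtr_ge0.
have s1 : s < 1 by rewrite -sqrtr1 ltr_sqrt.
have rs : r = s * s by rewrite -expr2 sqr_sqrtr.
have gs : geometric (1 - s)^-1 s n @[n --> \oo] --> (0 : R).
  by apply: cvg_geometric; rewrite ger0_norm.
apply: (squeeze_cvgr _ (cvg_cst 0) gs); apply: nearW => n /=.
rewrite mulr_ge0 ?exprn_ge0//= rs exprMn mulrA ler_wpM2r ?exprn_ge0//.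
rewrite -[leRHS]mul1r ler_pdivlMr ?subr_gt0// mulrC.
have := @mulrn_expr_le s n; rewrite s0 (ltW s1) => /(_ isT) /le_trans; apply.
by rewrite lerBlDr lerDl exprn_ge0.
Qed.

Lemma bernoulli_le y k : 0 <= y <= 1 -> 1 - k%:R * y <= (1 - y) ^+ k.
Proof.
move=> /andP[y0 y1]; elim: k => [|k IH]; first by rewrite mul0r subr0 expr0.
have y1' : 0 <= 1 - y by rewrite subr_ge0.
rewrite exprS; apply: le_trans (ler_wpM2l y1' IH).
rewrite -(natr1 k); have : 0 <= k%:R :> R by []; set m : R := k%:R; nra.
Qed.

Lemma bernoulli_ge y k : 0 <= y -> 1 + k%:R * y <= (1 + y) ^+ k.
Proof.
move=> y0; elim: k => [|k IH]; first by rewrite mul0r addr0 expr0.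
have y1 : 0 <= 1 + y by rewrite addr_ge0.
rewrite exprS; apply: le_trans (ler_wpM2l y1 IH).
rewrite -(natr1 k); have : 0 <= k%:R :> R by []; set m : R := k%:R; nra.
Qed.

(* The polynomials of Brosowski and Deutsch's proof of Stone-Weierstrass; the
   factor [n + 1] in the exponent forces the limit [0] at [y = 1/2] too. *)
Lemma step_cvg y : 0 <= y <= 1 ->
  (1 - y ^+ n) ^+ (2 ^ n * n.+1) @[n --> \oo] --> ((y < 2^-1)%R%:R : R).
Proof.
move=> /andP[y0 y1].
have yn0 n : 0 <= y ^+ n by rewrite exprn_ge0.
have yn1 n : y ^+ n <= 1 by rewrite exprn_ile1.
have kE n : (2 ^ n * n.+1)%:R * y ^+ n = n.+1%:R * (2 * y) ^+ n :> R.
  by rewrite natrM natrX exprMn; ring.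
(* Below [1/2], Bernoulli bounds the power from below by [1 - (n + 1) (2 y)^n]. From [1/2] on, with
   [k] the exponent, the power times [(1 + y^n)^k >= n + 1] equals [(1 - y^(2 n))^k <= 1]. *)
have [yh|yh] := ltP y 2^-1 => /=.
  have c0 : n.+1%:R * (2 * y) ^+ n @[n --> \oo] --> (0 : R).
    by apply: mulrn_expr_cvg0; apply/andP; split; lra.
  have c1 : 1 - n.+1%:R * (2 * y) ^+ n @[n --> \oo] --> (1 : R).
    suff : 1 - n.+1%:R * (2 * y) ^+ n @[n --> \oo] --> (1 - 0 : R) by rewrite subr0.
    by apply: cvgB => //; exact: cvg_cst.
  apply: (squeeze_cvgr _ c1 (@cvg_cst _ (1 : R) _ _ _)); apply: nearW => n.
  rewrite -kE bernoulli_le ?yn0 ?yn1//= exprn_ile1 ?subr_ge0//.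
  by rewrite lerBlDr lerDl.
apply: (squeeze_cvgr _ (cvg_cst 0) (@cvg_harmonic R)); apply: nearW => n /=.
rewrite exprn_ge0 ?subr_ge0//=.
rewrite -[leRHS]mul1r ler_pdivlMr//.
set k := (2 ^ n * n.+1)%N.
have kn : n.+1%:R <= (1 + y ^+ n) ^+ k.
  apply: le_trans (bernoulli_ge k (yn0 n)); rewrite kE.
  apply: ler_wpDl => //; rewrite ler_peMr// exprn_ege1//; lra.
have le0 : 0 <= (1 - y ^+ n) ^+ k by rewrite exprn_ge0 ?subr_ge0.
apply: le_trans (ler_wpM2l le0 kn) _; rewrite -exprMn.
have -> : (1 - y ^+ n) * (1 + y ^+ n) = 1 - (y ^+ n) ^+ 2 by ring.
rewrite exprn_ile1 ?subr_ge0 ?lerBlDr ?lerDl ?sqr_ge0//.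
by rewrite exprn_ile1.
Qed.

End StepApproximation.

(** * Multipliers and indicators composed with a multiplier *)

Section Multipliers.
Variable R : realType.
Variable e : int -> R -> R.
Hypothesis bm_e : forall n, bm (e n).
Hypothesis e_orth : forall n m, I01 (fun x => e n x * e m x) = (n == m)%:R.
Implicit Types (a b : int -> R) (u v g h : R -> R).
Local Notation apx := (approximable e).

(** A triangle inequality free of square roots; its factor 2 is why tolerances are divided by 4
    below. *)
Lemma I01_sqD_le g h : bm g -> bm h -> I01 (fun x => (g x + h x) ^+ 2) <=
  2 * I01 (fun x => g x ^+ 2) + 2 * I01 (fun x => h x ^+ 2).
Proof.
move=> bg bh; have b1 := bmX 2 bg; have b2 := bmX 2 bh.
rewrite -!I01Z// -I01D; [|exact: bmZ|exact: bmZ].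
apply: I01_le; [by apply: bmX; exact: bmD|by apply: bmD; exact: bmZ|].
by move=> x _; have := sqr_ge0 (g x - h x); nra.
Qed.

Lemma approximable_lim g : bm g ->
  (forall eps, 0 < eps -> exists h, [/\ bm h, apx h &
     I01 (fun x => (g x - h x) ^+ 2) <= eps]) -> apx g.
Proof.
move=> bg H eps eps0; have e4 : 0 < eps / 4 by rewrite divr_gt0.
have [h [bh ah gh]] := H _ e4; have [N [a Na]] := ah _ e4.
exists N, a; have bs := bm_synth bm_e N a.
have -> : (fun x => (g x - synth e N a x) ^+ 2) =
    (fun x => ((g x - h x) + (h x - synth e N a x)) ^+ 2).
  by apply/funext => x; ring.
by apply: le_trans (I01_sqD_le _ _) _; [exact: bmB|exact: bmB|lra].
Qed.

Lemma approximable_synth N a : apx (synth e N a).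
Proof.
move=> eps eps0; exists N, a.
under eq_fun do rewrite subrr expr0n.
by rewrite I01_cst ltW.
Qed.

Lemma approximable_e n : apx (e n).
Proof.
suff -> : e n = synth e `|n|%N (fun m => (n == m)%:R) by exact: approximable_synth.
apply/funext => x; rewrite /synth.
rewrite -[LHS](_ : trunc `|n|%N (fun m => e m x) n = _); last by rewrite /trunc leqnn.
by rewrite -psum_delta; apply: eq_psum => m; rewrite mulrC eq_sym.
Qed.

Lemma approximableD g h : bm g -> bm h -> apx g -> apx h -> apx (fun x => g x + h x).
Proof.
move=> bg bh ag ah eps eps0; have e4 : 0 < eps / 4 by rewrite divr_gt0.
have [N [a Na]] := ag _ e4; have [M [b Mb]] := ah _ e4.
pose K := maxn N M; pose c n := trunc N a n + trunc M b n.
exists K, c; have bs := bm_synth bm_e N a; have bs' := bm_synth bm_e M b.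
have -> : (fun x => (g x + h x - synth e K c x) ^+ 2) =
    (fun x => ((g x - synth e N a x) + (h x - synth e M b x)) ^+ 2).
  apply/funext => x.
  rewrite -(synth_trunc e a (leq_maxl N M)) -(synth_trunc e b (leq_maxr N M)).
  suff -> : synth e K c x = synth e K (trunc N a) x + synth e K (trunc M b) x by ring.
  by rewrite /synth -psumD; apply: eq_psum => n; rewrite mulrDl.
by apply: le_trans (I01_sqD_le _ _) _; [exact: bmB|exact: bmB|lra].
Qed.

Lemma approximableZ c g : bm g -> apx g -> apx (fun x => c * g x).
Proof.
move=> bg ag eps eps0; have c1 : 0 < c ^+ 2 + 1 by rewrite ltr_wpDl ?sqr_ge0.
have [N [a Na]] := ag (eps / (c ^+ 2 + 1)) (divr_gt0 eps0 c1).
exists N, (fun n => c * a n); have bs := bm_synth bm_e N a.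
have -> : (fun x => (c * g x - synth e N (fun n => c * a n) x) ^+ 2) =
    (fun x => c ^+ 2 * (g x - synth e N a x) ^+ 2).
  apply/funext => x.
  suff -> : synth e N (fun n => c * a n) x = c * synth e N a x by ring.
  by rewrite /synth -psumZ; apply: eq_psum => n; rewrite mulrA.
rewrite I01Z; last by apply: bmX; exact: bmB.
apply: le_trans (ler_wpM2l (sqr_ge0 c) Na) _.
rewrite mulrA ler_pdivrMr// mulrC ler_wpM2l// ?(ltW eps0)//.
by rewrite lerDl.
Qed.

Lemma approximable_psum N (F : int -> R -> R) : (forall n, bm (F n)) ->
  (forall n, apx (F n)) -> apx (fun x => psum N (F ^~ x)).
Proof.
move=> bF aF; elim: N => [|N IH].
  by under eq_fun do rewrite psum0; exact: aF.
have bN := bm_psum N bF.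
under eq_fun do rewrite psumS.
by apply: approximableD => //; [exact: bmD|exact: approximableD].
Qed.

(** By boundedness such a [v] sends every bounded measurable element of the closed span into the
    closed span ([multiplierM_apx]), so multipliers form an algebra. *)
Definition multiplier v := bm v /\ forall n, apx (fun x => v x * e n x).

Lemma multiplierM_apx v g : multiplier v -> bm g -> apx g -> apx (fun x => v x * g x).
Proof.
move=> [bv av] bg ag; apply: approximable_lim => [|eps eps0]; first exact: bmM.
have [mv [M vM]] := bv.
have M1 : 0 < M ^+ 2 + 1 by rewrite ltr_wpDl ?sqr_ge0.
have [N [a Na]] := ag (eps / (M ^+ 2 + 1)) (divr_gt0 eps0 M1).
have bs := bm_synth bm_e N a.
exists (fun x => v x * synth e N a x); split; first exact: bmM.
  have -> : (fun x => v x * synth e N a x) =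
      (fun x => psum N ((fun n x => a n * (v x * e n x)) ^~ x)).
    by apply/funext => x; rewrite -psumZ; apply: eq_psum => n; rewrite mulrCA.
  by apply: approximable_psum => n; [apply: bmZ; exact: bmM|
    apply: approximableZ => //; exact: bmM].
apply: le_trans (_ : I01 (fun x => M ^+ 2 * (g x - synth e N a x) ^+ 2) <= _).
  apply: I01_le => [||x _].
  - by apply: bmX; apply: bmB; exact: bmM.
  - by apply: bmZ; apply: bmX; exact: bmB.
  rewrite -mulrBr exprMn ler_wpM2r ?sqr_ge0// -(real_normK (num_real (v x))).
  by rewrite ler_sqr ?nnegrE// (le_trans _ (vM x)).
rewrite I01Z; last by apply: bmX; exact: bmB.
apply: le_trans (ler_wpM2l (sqr_ge0 M) Na) _.
rewrite mulrA ler_pdivrMr// mulrC ler_wpM2l// ?(ltW eps0)//.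
by rewrite lerDl.
Qed.

Lemma multiplier_cst c : multiplier (fun=> c).
Proof.
split; first exact: bm_cst.
by move=> n; apply: approximableZ => //; exact: approximable_e.
Qed.

Lemma multiplierM u v : multiplier u -> multiplier v -> multiplier (fun x => u x * v x).
Proof.
move=> mu [bv av]; split; first exact: bmM mu.1 bv.
move=> n; under eq_fun do rewrite -mulrA.
by apply: multiplierM_apx => //; exact: bmM.
Qed.

Lemma multiplierD u v : multiplier u -> multiplier v -> multiplier (fun x => u x + v x).
Proof.
move=> [bu au] [bv av]; split; first exact: bmD.
move=> n; under eq_fun do rewrite mulrDl.
by apply: approximableD => //; exact: bmM.
Qed.

Lemma multiplierZ c u : multiplier u -> multiplier (fun x => c * u x).
Proof. by move=> mu; apply: multiplierM => //; exact: multiplier_cst. Qed.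

Lemma multiplierB u v : multiplier u -> multiplier v -> multiplier (fun x => u x - v x).
Proof.
move=> mu mv; have := multiplierD mu (multiplierZ (-1) mv).
by under [X in multiplier X]eq_fun do rewrite mulN1r.
Qed.

Lemma multiplierX u n : multiplier u -> multiplier (fun x => u x ^+ n).
Proof.
move=> mu; elim: n => [|n IH]; first exact: multiplier_cst.
by under eq_fun do rewrite exprS; exact: multiplierM.
Qed.

Lemma multiplier_cvg (v_ : nat -> R -> R) v (M : R) : (forall n, multiplier (v_ n)) ->
  bm v -> (forall n x, 0 <= x <= 1 -> `|v_ n x| <= M) ->
  (forall x, 0 <= x <= 1 -> v_ n x @[n --> \oo] --> v x) -> multiplier v.
Proof.
move=> mv_ bv vM vv; split=> // m.
have bvm : bm (fun x => v x * e m x) by exact: bmM.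
apply: approximable_lim => // eps eps0.
pose d n x := (v x * e m x - v_ n x * e m x) ^+ 2.
have [_ [C vC]] := bv; have [_ [K eK]] := bm_e m.
have d0 : I01 (d n) @[n --> \oo] --> (0 : R).
  rewrite -(I01_cst (0 : R)).
  apply: (I01_cvg (M := ((C + M) * K) ^+ 2)) => [n||n x x01|x x01].
  - by apply: bmX; apply: bmB => //; exact: bmM (mv_ n).1 _.
  - exact: bm_cst.
  - rewrite /d normrX lerXn2r ?nnegrE ?normr_ge0//.
      rewrite mulr_ge0 ?addr_ge0//.
      + by apply: le_trans (vC x).
      + by apply: le_trans (vM n x x01).
      + by apply: le_trans (eK x).
    rewrite -mulrBl normrM ler_pM//.
    by apply: le_trans (ler_normB _ _) _; apply: lerD => //; exact: vM.
  - have c : v x * e m x - v_ n x * e m x @[n --> \oo] --> v x * e m x - v x * e m x.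
      by apply: cvgB; [exact: cvg_cst|apply: cvgM; [exact: vv|exact: cvg_cst]].
    rewrite /d; under eq_fun do rewrite expr2.
    by have := cvgM c c; rewrite subrr mul0r; apply.
move/cvgr0Pnorm_le/(_ _ eps0): d0 => [n _ /(_ n (leqnn n)) dn].
exists (fun x => v_ n x * e m x); split; first exact: bmM (mv_ n).1 _.
  exact: (mv_ n).2.
by apply: le_trans dn; exact: ler_norm.
Qed.

Variable F : R -> R.
Hypothesis mF : multiplier F.

Lemma bm_indic (A : set (measurableTypeR R)) : measurable A -> bm (fun x => \1_A (F x)).
Proof.
move=> mA; split; last first.
  by exists 1 => x; rewrite indicE; case: (_ \in _); rewrite ?normr1 ?normr0.
by apply: measurableT_comp; [exact: measurable_indic|exact: mF.1.1].
Qed.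

Lemma multiplier_ray c :
  multiplier (fun x => \1_(`]-oo, c[%classic : set (measurableTypeR R)) (F x)).
Proof.
have [[_ [M FM]] _] := mF.
have M0 : 0 <= M by apply: le_trans (FM 0).
(* This scale makes [G] an affine image of [F] with values in [[1/4, 3/4]] that crosses [1/2]
   exactly where [F] crosses [c], so that [step_cvg] applies. *)
pose K := 4 * (M + `|c| + 1); have K0 : 0 < K.
  by rewrite mulr_gt0// ltr_wpDl// addr_ge0.
pose G x := K^-1 * (F x - c) + 2^-1.
have mG : multiplier G.
  apply: multiplierD; last exact: multiplier_cst.
  by apply: multiplierZ; apply: multiplierB => //; exact: multiplier_cst.
have G01 x : 0 <= G x <= 1.
  have : `|K^-1 * (F x - c)| <= 4^-1.
    rewrite normrM gtr0_norm ?invr_gt0// mulrC ler_pdivrMr//.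
    rewrite /K mulrA mulVf// mul1r.
    have := FM x; have := ler_normB (F x) c; lra.
  by rewrite ler_norml /G; lra.
have GE x : (G x < 2^-1) = (F x < c).
  rewrite /G -[X in _ < X]add0r ltrD2r pmulr_rlt0 ?invr_gt0//.
  by rewrite subr_lt0.
have q01 n x : 0 <= 1 - G x ^+ n <= 1.
  have /andP[G0 G1] := G01 x.
  by rewrite subr_ge0 exprn_ile1// lerBlDr lerDl exprn_ge0.
apply: (multiplier_cvg (v_ := fun n x => (1 - G x ^+ n) ^+ (2 ^ n * n.+1)) (M := 1)).
- move=> n; apply: multiplierX; apply: multiplierB; first exact: multiplier_cst.
  exact: multiplierX.
- by apply: bm_indic; exact: measurable_itv.
- move=> n x _; have /andP[q0 q1] := q01 n x.
  by rewrite normrX exprn_ile1// ger0_norm.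
- move=> x _; have := step_cvg (G01 x); rewrite GE indicE.
  suff -> : (F x \in `]-oo, c[%classic) = (F x < c) by [].
  by apply/idP/idP; rewrite inE/= in_itv.
Qed.

(** The sets with this property form a sigma-algebra containing the open left rays, which generate
    the Borel sets. Countable unions are handled as bounded pointwise limits of finite ones. *)
Lemma multiplier_indic (A : set (measurableTypeR R)) : measurable A ->
  multiplier (fun x => \1_A (F x)).
Proof.
move: A; pose C := [set A : set (measurableTypeR R) |
  measurable A /\ multiplier (fun x => \1_A (F x))].
suff CA : measurable `<=` C by move=> A /CA[].
rewrite [X in X `<=` _](RGenInftyO.measurableE R).
apply: smallest_sub; last first.
  by move=> _ [c ->]; split; [exact: measurable_itv|exact: multiplier_ray].
have CI (A B : set (measurableTypeR R)) : C A -> C B -> C (A `&` B).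
  move=> [mA cA] [mB cB]; split; first exact: measurableI.
  by rewrite indicI; exact: multiplierM.
have CC (A : set (measurableTypeR R)) : C A -> C (~` A).
  move=> [mA cA]; split; first exact: measurableC.
  have := multiplierB (multiplier_cst 1) cA.
  suff -> : (fun x => 1 - \1_A (F x)) = (fun x => \1_(~` A) (F x)) :> (R -> R) by [].
  by apply/funext => x; rewrite !indicE in_setC; case: (_ \in _); rewrite ?subr0 ?subrr.
have CU (A B : set (measurableTypeR R)) : C A -> C B -> C (A `|` B).
  by move=> cA cB; rewrite -[_ `|` _]setCK setCU; apply/CC/CI; exact: CC.
have C0 : C set0.
  split; first exact: measurable0.
  by under eq_fun do rewrite indic0; exact: multiplier_cst.
split=> //.
  by move=> A cA; rewrite setTD; exact: CC.
move=> A cA; have mU : measurable (\bigcup_k A k).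
  by apply: bigcup_measurable => k _; exact: (cA k).1.
split=> //; pose B n := \big[setU/set0]_(i < n) A i.
have cB n : C (B n).
  by rewrite /B; elim/big_ind: _ => // i _; exact: cA.
apply: (multiplier_cvg (v_ := fun n x => \1_(B n) (F x)) (M := 1)).
- by move=> n; exact: (cB n).2.
- exact: bm_indic.
- by move=> n x _; rewrite indicE; case: (_ \in _); rewrite ?normr1 ?normr0.
- move=> x _; apply: cvg_near_cst.
  have [[k _ Ak]|nA] := pselect ((\bigcup_k A k) (F x)).
    exists k.+1 => // n /= kn; apply/eqP; rewrite !indicE.
    rewrite !mem_set//; first by exists k.
    by rewrite /B -bigcup_mkord; exists k.
  apply: nearW => n; rewrite !indicE !memNset//.
  by rewrite /B -bigcup_mkord => -[k _ Ak]; apply: nA; exists k.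
Qed.

(** By symmetry [oper v] moves to the row of [u]. The entries become inner products of the
    coefficients of [v e_m] and [u e_n], and Parseval applies because [v e_m] lies in the closed
    span. *)
Lemma oper_oper (u v : R -> R) b : bm u -> multiplier v -> l2 b ->
  oper e u (oper e v b) = oper e (fun x => u x * v x) b.
Proof.
move=> bu mv lb; have bv := mv.1; apply/funext => n.
have [_ [M vM]] := bv.
have vM' (x : R) : 0 <= x <= 1 -> `|v x| <= M by [].
have lK := l2_kernel bm_e e_orth n bu.
rewrite [LHS]operE.
have -> : dot (kernel e u n) (oper e v b) = dot (oper e v (kernel e u n)) b.
  exact: (oper_sym bm_e e_orth bv vM').
rewrite operE; congr dot; apply/funext => m.
rewrite operE !kernel_coef (parseval bm_e)//; [|exact: bmM|exact: bmM|exact: mv.2].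
rewrite -kernel_coef kernelC /kernel; congr I01; apply/funext => x; ring.
Qed.

End Multipliers.

(** * Finite measures from countably additive real set functions *)

Section FiniteMeasureOfSetFunction.
Variable R : realType.
Local Notation T := (measurableTypeR R).

Record set_function := SetFunction {
  sf :> set T -> R;
  sf0 : sf set0 = 0;
  sf_ge0 : forall A, measurable A -> 0 <= sf A;
  sf_sigma : forall F : (set T)^nat, (forall n, measurable (F n)) ->
    trivIset setT F -> measurable (\bigcup_n F n) ->
    \sum_(0 <= i < n) sf (F i) @[n --> \oo] --> sf (\bigcup_n F n) }.

(* [isMeasure] requires nonnegativity on non-measurable sets as well. *)
Definition measure_of (m : set_function) (A : set T) : \bar R :=
  (if `[< measurable A >] then m A else 0)%:E.

Variable m : set_function.

Lemma measure_ofE A : measurable A -> measure_of m A = (m A)%:E.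
Proof. by move=> mA; rewrite /measure_of asboolT. Qed.

Let measure_of0 : measure_of m set0 = 0%E.
Proof. by rewrite measure_ofE// sf0. Qed.

Let measure_of_ge0 A : (0 <= measure_of m A)%E.
Proof. by rewrite /measure_of; case: asboolP => // mA; rewrite lee_fin sf_ge0. Qed.

Let measure_of_sigma : semi_sigma_additive (measure_of m).
Proof.
move=> F mF tF mUF; rewrite measure_ofE//.
rewrite (_ : (fun n => _) = EFin \o (fun n => \sum_(0 <= i < n) m (F i))).
  by apply: cvg_EFin; [exact: nearW|exact: sf_sigma].
by apply/funext => n /=; rewrite -sumEFin; apply: eq_bigr => i _; rewrite measure_ofE.
Qed.

HB.instance Definition _ := isMeasure.Build _ T R (measure_of m)
  measure_of0 measure_of_ge0 measure_of_sigma.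

Let measure_of_fin : fin_num_fun (measure_of m).
Proof. by move=> A mA; rewrite measure_ofE. Qed.

HB.instance Definition _ := Measure_isFinite.Build _ T R (measure_of m) measure_of_fin.

Lemma exists_finite_measure : exists mu : {finite_measure set T -> \bar R},
  forall A, measurable A -> mu A = (m A)%:E.
Proof. by exists (measure_of m) => A; exact: measure_ofE. Qed.

End FiniteMeasureOfSetFunction.

(** * Real and imaginary parts of complex sequences *)

Section ComplexSequences.
Variable R : realType.
Implicit Types (g : int -> R) (phi psi : int -> R[i]).
Local Open Scope complex_scope.

Definition reseq psi n : R := complex.Re (psi n).
Definition imseq psi n : R := complex.Im (psi n).

Lemma summable_psum g : (forall n, 0 <= g n) ->
  summable [set: int] (fun n => (g n)%:E) <-> exists C, forall N, psum N g <= C.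
Proof.
move=> g0; have absg : (fun n => `|(g n)%:E|%E) = (fun n => (g n)%:E).
  by apply/funext => n; rewrite gee0_abs ?lee_fin.
pose r N : seq int := [seq j%:Z - N%:Z | j <- index_iota 0 N.*2.+1].
have ur N : uniq (r N) by rewrite map_inj_uniq ?iota_uniq// => i j; lia.
have rE N (n : int) : (n \in r N) = (`|n| <= N)%N.
  apply/mapP/idP => [[j]|nN]; first by rewrite mem_index_iota => jN ->; lia.
  exists (absz (n + N%:Z)); last by lia.
  by rewrite mem_index_iota; lia.
have sE N : \sum_(n \in [set` r N]) (g n)%:E = (psum N g)%:E.
  by rewrite -fsbig_seq// big_map sumEFin.
rewrite /summable absg; split=> [fin|[C gC]].
  exists (fine (\esum_(n in setT) (g n)%:E)) => N; rewrite -lee_fin fineK.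
    by apply: esum_ge; exists [set` r N]; [split=> //; exact: finite_seq|rewrite sE].
  by rewrite ge0_fin_numE//; apply: esum_ge0 => n _; rewrite lee_fin.
apply: (@le_lt_trans _ _ C%:E); last by rewrite ltry.
rewrite ge_ereal_sup => //= _ [X [finX _]] <-.
(* The sum of all [|n|] over the finite set is a crude bound for its elements. *)
have [N XN] : exists N, forall n, X n -> (`|n| <= N)%N.
  have /finite_seqP[s Xs] := finX; exists (\sum_(n <- s) `|n|)%N => n.
  by rewrite Xs/= => ns; rewrite (big_rem n)//= leq_addr.
apply: le_trans (_ : (\sum_(n \in [set` r N]) (g n)%:E <= _)%E); last first.
  by rewrite sE lee_fin.
apply: lee_fsum_nneg_subset => //; first exact: finite_seq.
  by move=> n; rewrite !inE/= rE => Xn; exact: XN.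
by move=> n _; rewrite lee_fin.
Qed.

Lemma ell2P psi : ell2 psi <-> l2 (reseq psi) /\ l2 (imseq psi).
Proof.
rewrite /ell2 summable_psum; last by move=> n; rewrite addr_ge0 ?sqr_ge0.
split=> [[C pC]|[[C aC] [D bD]]].
  by split; exists C => N; apply: le_trans (pC N); apply: ler_psum => n;
     rewrite ?lerDl ?lerDr sqr_ge0.
by exists (C + D) => N; rewrite psumD; exact: lerD.
Qed.

Lemma innerE phi psi : ell2 phi -> ell2 psi -> inner phi psi =
  (dot (reseq phi) (reseq psi) + dot (imseq phi) (imseq psi)) +i*
  (dot (reseq phi) (imseq psi) - dot (imseq phi) (reseq psi)).
Proof.
move=> /ell2P[a b] /ell2P[c d]; rewrite /inner /zsumC; congr (_ +i* _).
  rewrite (_ : (fun k => _) =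
      (fun k => reseq phi k * reseq psi k + imseq phi k * imseq psi k)).
    apply: cvg_zsum; under eq_fun do rewrite psumD.
    by apply: cvgD; exact: dot_cvg.
  by apply/funext => k; rewrite /reseq /imseq; case: (phi k) (psi k) => x y [z t] /=; ring.
rewrite (_ : (fun k => _) =
    (fun k => reseq phi k * imseq psi k - imseq phi k * reseq psi k)).
  apply: cvg_zsum; under eq_fun do rewrite psumB.
  by apply: cvgB; exact: dot_cvg.
by apply/funext => k; rewrite /reseq /imseq; case: (phi k) (psi k) => x y [z t] /=; ring.
Qed.

Lemma reseq_lin x y phi psi : reseq (fun n => (x +i* y) * phi n + psi n) =
  fun n => x * reseq phi n + (- y * imseq phi n + reseq psi n).
Proof.
apply/funext => n; rewrite /reseq /imseq.
by case: (phi n) (psi n) => ? ? [? ?] /=; ring.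
Qed.

Lemma imseq_lin x y phi psi : imseq (fun n => (x +i* y) * phi n + psi n) =
  fun n => x * imseq phi n + (y * reseq phi n + imseq psi n).
Proof.
apply/funext => n; rewrite /reseq /imseq.
by case: (phi n) (psi n) => ? ? [? ?] /=; ring.
Qed.

Lemma ell2_lin (c : R[i]) phi psi : ell2 phi -> ell2 psi ->
  ell2 (fun n => c * phi n + psi n).
Proof.
case: c => x y /ell2P[pr pi] /ell2P[sr si]; apply/ell2P.
by rewrite reseq_lin imseq_lin; split; apply: l2D => //;
   [exact: l2Z|apply: l2D => //; exact: l2Z|exact: l2Z|apply: l2D => //; exact: l2Z].
Qed.

End ComplexSequences.

(** * The spectral theorem for multiplication operators *)

Section Counting.
Variable R : realType.

(** The sum is the integer part of [y]. It serves to write a staircase approximation of the identity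
    as a combination of indicators of rays. *)
Lemma count_le_bounds (J : nat) (y : R) : 0 <= y <= J%:R ->
  `|y - \sum_(0 <= j < J) (j.+1%:R <= y)%R%:R| <= 1.
Proof.
move=> /andP[y0]; elim: J => [|J IH] yJ.
  by rewrite big_nil subr0 ger0_norm//; lra.
rewrite big_nat_recr//=; have [yJ'|Jy] := lerP y J%:R.
  rewrite [J.+1%:R <= y]lt_geF ?addr0 ?IH//.
  by apply: le_lt_trans yJ' _; rewrite ltr_nat.
rewrite big_nat (eq_bigr (fun=> 1)) => [|j /andP[_ jJ]]; last first.
  by rewrite (le_trans _ (ltW Jy))// ler_nat.
rewrite -big_nat sumr_const_nat subn0 -natr1 in yJ *.
by rewrite ler_norml; have [?|?] := lerP (J%:R + 1) y => /=; apply/andP; split; lra.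
Qed.

End Counting.

(** * Spectral family and spectral measures of a multiplication operator *)

Section SpectralTheorem.
Variable R : realType.
Variable e : int -> R -> R.
Hypothesis bm_e : forall n, bm (e n).
Hypothesis e_orth : forall n m, I01 (fun x => e n x * e m x) = (n == m)%:R.
Implicit Types (a b : int -> R) (u v : R -> R) (phi psi : int -> R[i]).
Local Open Scope complex_scope.
Local Notation oper := (oper e).
Local Notation T := (measurableTypeR R).

Definition operC u psi (n : int) : R[i] :=
  oper u (reseq psi) n +i* oper u (imseq psi) n.

Definition formC psi u : R :=
  dot (reseq psi) (oper u (reseq psi)) + dot (imseq psi) (oper u (imseq psi)).

Lemma ell2_operC u psi : bm u -> ell2 psi -> ell2 (operC u psi).
Proof.
move=> bu /ell2P[lr li]; have [M uM] := bm_bound bu.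
by apply/ell2P; split; exact: (l2_oper bm_e e_orth bu uM).
Qed.

Lemma operC_selfadjoint u : bm u -> selfadjoint_operator (operC u).
Proof.
move=> bu; have [M uM] := bm_bound bu.
split; first split.
- by move=> psi; exact: ell2_operC.
- move=> [x y] phi psi /ell2P[pr pi] /ell2P[sr si].
  have l1 : l2 (fun n => - y * imseq phi n + reseq psi n) by apply: l2D => //; exact: l2Z.
  have l1' : l2 (fun n => y * reseq phi n + imseq psi n) by apply: l2D => //; exact: l2Z.
  rewrite /operC reseq_lin imseq_lin !(oper_linear bm_e e_orth bu)//.
  by apply/funext => n; congr (_ +i* _); ring.
- move=> phi psi lp ls; have [pr pi] := (ell2P _).1 lp; have [sr si] := (ell2P _).1 ls.
  rewrite !innerE//; [|exact: ell2_operC|exact: ell2_operC].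
  by congr ((_ + _) +i* (_ - _)); exact: (oper_sym bm_e e_orth bu uM).
Qed.

(** The imaginary part vanishes because the real matrix [kernel u] is symmetric. *)
Lemma inner_operC u psi : bm u -> ell2 psi ->
  inner psi (operC u psi) = (formC psi u)%:C.
Proof.
move=> bu ls; have [lr li] := (ell2P _).1 ls; have [M uM] := bm_bound bu.
rewrite innerE//; last exact: ell2_operC.
congr (_ +i* _); apply/eqP; rewrite subr_eq0; apply/eqP.
transitivity (dot (oper u (reseq psi)) (imseq psi)); last exact: dotC.
exact: (oper_sym bm_e e_orth bu uM).
Qed.

Lemma formC_ge0 u psi : bm u -> ell2 psi -> (forall x, 0 <= u x) -> 0 <= formC psi u.
Proof.
move=> bu /ell2P[lr li] u0; have [M uM] := bm_bound bu.
by rewrite addr_ge0//; exact: (form_ge0 bm_e e_orth bu uM).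
Qed.

Lemma formCD u v psi : bm u -> bm v -> ell2 psi ->
  formC psi (fun x => u x + v x) = formC psi u + formC psi v.
Proof.
move=> bu bv /ell2P[lr li]; have [M uM] := bm_bound bu; have [K vK] := bm_bound bv.
have lu a : l2 a -> l2 (oper u a) by exact: (l2_oper bm_e e_orth bu uM).
have lv a : l2 a -> l2 (oper v a) by exact: (l2_oper bm_e e_orth bv vK).
have E a : l2 a -> dot a (oper (fun x => u x + v x) a) =
    dot a (oper u a) + dot a (oper v a).
  by move=> la; rewrite (operDs bm_e e_orth bu bv la) (dotDr la (lu _ la) (lv _ la)).
by rewrite /formC (E _ lr) (E _ li) addrACA.
Qed.

Lemma formCZ c u psi : bm u -> ell2 psi ->
  formC psi (fun x => c * u x) = c * formC psi u.
Proof.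
move=> bu /ell2P[lr li]; have [M uM] := bm_bound bu.
have lu a : l2 a -> l2 (oper u a) by exact: (l2_oper bm_e e_orth bu uM).
have E a : l2 a -> dot a (oper (fun x => c * u x) a) = c * dot a (oper u a).
  by move=> la; rewrite (operZs bm_e e_orth c bu la) (dotZr c la (lu _ la)).
by rewrite /formC (E _ lr) (E _ li) mulrDr.
Qed.

Lemma formC_sum (u : nat -> R -> R) n psi : (forall i, bm (u i)) -> ell2 psi ->
  formC psi (fun x => \sum_(0 <= i < n) u i x) = \sum_(0 <= i < n) formC psi (u i).
Proof.
move=> bu lp; elim: n => [|n IH].
  under eq_fun do rewrite big_nil -(mul0r 1).
  by rewrite big_nil formCZ ?mul0r//; exact: bm_cst.
have -> : (fun x => \sum_(0 <= i < n.+1) u i x) =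
    (fun x => \sum_(0 <= i < n) u i x + u n x).
  by apply/funext => x; rewrite big_nat_recr.
have bs : bm (fun x => \sum_(0 <= i < n) u i x) by exact: bm_sum.
by rewrite (formCD bs (bu n) lp) IH [RHS]big_nat_recr.
Qed.

Lemma formC_cvg (u_ : nat -> R -> R) u M psi : (forall n, bm (u_ n)) -> bm u ->
  (forall n (x : R), 0 <= x <= 1 -> `|u_ n x| <= M) ->
  (forall x : R, 0 <= x <= 1 -> u_ n x @[n --> \oo] --> u x) -> ell2 psi ->
  formC psi (u_ n) @[n --> \oo] --> formC psi u.
Proof.
move=> bu_ bu uM uu /ell2P[lr li].
by apply: cvgD; exact: (form_cvg bm_e e_orth bu_ bu uM uu).
Qed.

(** All matrix entries vanish. For [u = \1_A \o F] this is the absolute continuity of the spectral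
    measures with respect to the image of Lebesgue measure on [[0, 1]] under [F]. *)
Lemma formC_ae0 u psi (N : set R) : bm u -> measurable N ->
  lebesgue_measure N = 0%E -> (forall x, 0 <= x <= 1 -> ~ N x -> u x = 0) ->
  formC psi u = 0.
Proof.
move=> bu mN N0 uN.
have K0 n m : kernel e u n m = 0.
  by apply: (I01_ae0 _ mN N0); [exact: bm_kernel|move=> x x01 Nx; rewrite uN// !mul0r].
have O0 a n : oper u a n = 0.
  apply: cvg_zsum; rewrite (_ : (fun N => _) = cst 0); first exact: cvg_cst.
  by apply/funext => M; apply: big1 => j _; rewrite K0 mul0r.
suff D0 a : dot a (oper u a) = 0 by rewrite /formC !D0 addr0.
apply: cvg_zsum; rewrite (_ : (fun N => _) = cst 0); first exact: cvg_cst.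
by apply/funext => M; apply: big1 => j _; rewrite O0 mulr0.
Qed.

Variable F : R -> R.
Hypothesis mF : multiplier e F.

Let bA (A : set T) (mA : measurable A) : bm (fun x => \1_A (F x)) :=
  @bm_indic R e F mF A mA.

Let mA (A : set T) (mA : measurable A) : multiplier e (fun x => \1_A (F x)) :=
  @multiplier_indic R e bm_e F mF A mA.

Definition spectral_family (A : set T) := operC (fun x => \1_A (F x)).

Lemma operC_operC u v psi : bm u -> multiplier e v -> ell2 psi ->
  operC u (operC v psi) = operC (fun x => u x * v x) psi.
Proof.
move=> bu mv /ell2P[lr li]; apply/funext => n; congr (_ +i* _).
  by rewrite -(oper_oper bm_e e_orth bu mv lr).
by rewrite -(oper_oper bm_e e_orth bu mv li).
Qed.

(** Disjointness bounds the partial sums of indicators by 1, and at each point they are eventually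
    constant, so [formC_cvg] applies. *)
Lemma formC_spectral_sigma psi (G : (set T)^nat) : ell2 psi ->
  (forall n, measurable (G n)) -> trivIset setT G -> measurable (\bigcup_n G n) ->
  \sum_(0 <= i < n) formC psi (fun x => \1_(G i) (F x)) @[n --> \oo]
  --> formC psi (fun x => \1_(\bigcup_n G n) (F x)).
Proof.
move=> lp mG tG mU; have bG i := bA (mG i).
under eq_fun do rewrite -formC_sum//.
have bnd n x : `|\sum_(0 <= i < n) \1_(G i) (F x)| <= (1 : R).
  rewrite ger0_norm; last by apply: sumr_ge0 => i _; rewrite indicE.
  have [[k /= kn Gk]|nG] := pselect (exists2 k, (k < n)%N & G k (F x)).
    rewrite big_mkord (bigD1 (Ordinal kn))//= big1 ?addr0.
      by rewrite indicE; case: (_ \in _).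
    move=> i ik; rewrite indicE memNset// => Gi.
    move/eqP: ik; apply; apply: val_inj => /=.
    by apply: tG => //; exists (F x).
  rewrite big_nat big1// => i /andP[_ ni]; rewrite indicE memNset// => Gi.
  by apply: nG; exists i.
apply: (formC_cvg (M := 1)) => // [n||x _].
- by apply: bm_sum.
- exact: bA mU.
- have [[k _ Gk]|nU] := pselect ((\bigcup_n G n) (F x)); last first.
    apply: cvg_near_cst; apply: nearW => n; rewrite [RHS]indicE memNset//=.
    rewrite big1// => i _; rewrite indicE memNset// => Gi; apply: nU.
    by exists i.
  apply: cvg_near_cst; exists k.+1 => // n /= kn.
  rewrite [RHS]indicE mem_set; last by exists k.
  rewrite big_mkord (bigD1 (Ordinal kn))//= indicE mem_set//= big1 ?addr0//.
  move=> i ik; rewrite indicE memNset// => Gi.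
  move/eqP: ik; apply; apply: val_inj => /=.
  by apply: tG => //; exists (F x).
Qed.

Lemma spectral_family_pvm : projection_valued_measure spectral_family.
Proof.
split.
- move=> A mA'; split; first by apply: operC_selfadjoint; exact: bA.
  move=> psi lp; rewrite /spectral_family (operC_operC (bA mA') (mA mA') lp).
  suff -> : (fun x => \1_A (F x) * \1_A (F x)) = (fun x => \1_A (F x)) :> (R -> R) by [].
  by apply/funext => x; rewrite indicE; case: (_ \in _); rewrite ?mulr0 ?mulr1.
- move=> psi lp; have [lr li] := (ell2P _).1 lp.
  rewrite /spectral_family.
  have -> : (fun x => \1_[set: T] (F x)) = (fun=> 1 : R).
    by apply/funext => x; rewrite indicT.
  apply/funext => n; rewrite /operC (oper_cst bm_e e_orth 1 lr).
  rewrite (oper_cst bm_e e_orth 1 li) !mul1r.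
  by rewrite /reseq /imseq; case: (psi n).
- move=> A B psi mA' mB lp.
  by rewrite /spectral_family (operC_operC (bA mA') (mA mB) lp) indicI.
- move=> psi lp.
  have s0 : formC psi (fun x => \1_(set0 : set T) (F x)) = 0.
    under eq_fun do rewrite indic0 -(mul0r 1).
    by rewrite formCZ ?mul0r//; exact: bm_cst.
  have s1 (A : set T) : measurable A -> 0 <= formC psi (fun x => \1_A (F x)).
    by move=> mA'; apply: (formC_ge0 (bA mA') lp) => x; rewrite indicE.
  have [mu muE] := exists_finite_measure (SetFunction s0 s1
    (fun G mG tG mU => formC_spectral_sigma lp mG tG mU)).
  by exists mu => A mA'; rewrite (muE A mA') (inner_operC (bA mA') lp).
Qed.

Lemma scalar_measureE psi mu : ell2 psi ->
  scalar_spectral_measure spectral_family psi mu ->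
  forall A : set T, measurable A -> mu A = (formC psi (fun x => \1_A (F x)))%:E.
Proof.
move=> lp muE A mA'; have := muE A mA'.
rewrite /spectral_family (inner_operC (bA mA') lp).
move=> /(congr1 (@complex.Re R))/= ->; rewrite fineK//.
exact: fin_num_measure.
Qed.

(** The measure is carried by an interval [S] containing the range of [F]. There the identity is a
    uniform limit of step functions, for which the integral against [mu] and the form of the
    composition with [F] agree. *)
Lemma spectral_family_integral psi (mu : {finite_measure set T -> \bar R}) :
  ell2 psi -> scalar_spectral_measure spectral_family psi mu ->
  mu.-integrable setT (fun x : T => ((x : R) ^+ 2)%:E) /\
  \int[mu]_(x in setT) (x : R) = formC psi F.
Proof.
move=> lp /(scalar_measureE lp) muE.
have [K FK] := mF.1.2; pose M := K + 1.
have K0 : 0 <= K by apply: le_trans (FK 0).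
have M0 : 0 < M by rewrite ltr_wpDl.
have FM x : - M <= F x <= M by have := FK x; rewrite ler_norml /M; lra.
pose S : set T := `[- M, M]%classic.
have mS : measurable S by exact: measurable_itv.
have SF x : S (F x) by rewrite /S/= in_itv/= FM.
have muSE (A : set T) : measurable A -> mu (A `&` S) = mu A.
  move=> mA'; rewrite (muE _ (measurableI _ _ mA' mS)) (muE _ mA').
  congr (formC _ _)%:E; apply/funext => x; rewrite indicI.
  have -> : (\1_A \* \1_S) (F x) = \1_A (F x) * \1_S (F x) :> R by [].
  by rewrite [\1_S _]indicE mem_set ?mulr1.
have muS0 : mu (~` S) = 0%E.
  by rewrite -muSE; [rewrite setICl measure0|exact: measurableC].
have intS (g : T -> R) : measurable_fun setT g ->
    (exists C, forall x, S x -> `|g x| <= C) -> mu.-integrable S (EFin \o g).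
  move=> mg [C gC]; apply: measurable_bounded_integrable => //.
  - by rewrite ltey_eq fin_num_measure.
  - exact: measurable_funS mg.
  - exists C; split; first exact: num_real.
    by move=> D CD x Sx; apply: le_trans (gC x Sx) (ltW CD).
have intT (g : T -> R) : measurable_fun setT g ->
    (exists C, forall x, S x -> `|g x| <= C) -> mu.-integrable setT (EFin \o g).
  move=> mg gC; rewrite (negligible_integrable (N := ~` S))//.
  - by rewrite setTD setCK; exact: intS.
  - exact: measurableC.
  - by apply/measurable_EFinP.
have SM (x : T) : S x -> `|x : R| <= M by rewrite /S/= in_itv/= ler_norml.
have mid : measurable_fun [set: T] (fun x : T => (x : R)) by [].
have cid : exists C, forall x, S x -> `|(x : R)| <= C by exists M.
split.
  apply: intT; first exact: measurable_funX.
  exists (M ^+ 2) => x Sx; rewrite normrX; apply: lerXn2r; rewrite ?nnegrE ?(ltW M0)//.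
  exact: SM.
have -> : \int[mu]_(x in setT) (x : R) = \int[mu]_(x in S) (x : R).
  rewrite /Rintegral (negligible_integral (N := ~` S))//.
  - by rewrite setTD setCK.
  - exact: measurableC.
  - exact: intT.
(* The class of [u] for which the change of variables holds; it contains indicators and is closed
   under linear combinations. *)
pose P (u : R -> R) := [/\ bm u, bm (u \o F) &
  \int[mu]_(x in S) u x = formC psi (u \o F)].
have iP u : bm u -> mu.-integrable S (EFin \o u).
  by move=> [mu' [C uC]]; apply: intS => //; exists C.
have PA (A : set T) : measurable A -> P \1_A.
  move=> mA'; split; [|exact: bA mA'|].
    split; first exact: measurable_indic.
    by exists 1 => x; rewrite indicE; case: (_ \in _); rewrite ?normr1 ?normr0.
  transitivity (fine (mu (A `&` S))); first by congr fine; exact: integral_indic.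
  by rewrite (muSE _ mA') (muE _ mA').
have PZ c u : P u -> P (fun x => c * u x).
  move=> [bu buF uE]; split; [exact: bmZ|exact: bmZ buF|].
  by rewrite RintegralZl ?uE ?(formCZ c buF lp)//; exact: iP.
have PD u v : P u -> P v -> P (fun x => u x + v x).
  move=> [bu buF uE] [bv bvF vE]; split; [exact: bmD|exact: bmD buF bvF|].
  by rewrite RintegralD ?uE ?vE ?(formCD buF bvF lp)//; exact: iP.
have P1 : P (fun=> 1).
  by have := PA setT measurableT; rewrite indicT.
have Pcst c : P (fun=> c).
  by have := PZ c _ P1; under eq_fun do rewrite mulr1.
have Psum n (u : nat -> R -> R) : (forall j, P (u j)) ->
    P (fun x => \sum_(0 <= j < n) u j x).
  move=> Pu; elim: n => [|n IH]; first by under eq_fun do rewrite big_nil; exact: Pcst.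
  suff -> : (fun x => \sum_(0 <= j < n.+1) u j x) =
    (fun x => \sum_(0 <= j < n) u j x + u n x) by exact: PD IH (Pu n).
  by apply/funext => x; rewrite big_nat_recr.
(* The interval [[- M, M]] is cut into [n + 1] pieces of length [c n], and [s n] jumps by [c n] at
   the right end of each, so on it [s n] rounds down to this grid. *)
pose st n (j : nat) : set T := `[- M + 2 * M * j.+1%:R / n.+1%:R, +oo[%classic.
pose c (n : nat) := 2 * M / n.+1%:R.
pose s n (x : R) : R := - M + c n * \sum_(0 <= j < n.+1) \1_(st n j) x.
have Ps n : P (s n).
  apply: (PD _ _ (Pcst (- M)) (PZ (c n) _ (Psum n.+1 (fun j => \1_(st n j)) _))) => j.
  by apply: PA; exact: measurable_itv.
have c0 n : 0 < c n by rewrite divr_gt0// mulr_gt0.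
have sx n x : - M <= x <= M -> `|x - s n x| <= c n.
  move=> xM; pose y := (x + M) / c n.
  have yJ : 0 <= y <= n.+1%:R.
    rewrite divr_ge0 ?(ltW (c0 n))//=; last lra.
    rewrite ler_pdivrMr// /c mulrCA mulfV ?mulr1//; lra.
  have := count_le_bounds yJ.
  rewrite -(ler_pM2l (c0 n)) mulr1; apply: le_trans.
  rewrite -[X in X * _](gtr0_norm (c0 n)) -normrM mulrBr.
  rewrite /y mulrC divfK ?gt_eqF// /s.
  suff -> : \sum_(0 <= j < n.+1) (j.+1%:R <= (x + M) / c n)%R%:R =
      \sum_(0 <= j < n.+1) \1_(st n j) x :> R.
    by rewrite opprD opprK addrA.
  apply: eq_bigr => j _; rewrite indicE; congr (nat_of_bool _)%:R.
  have -> : (x \in st n j) = (- M + 2 * M * j.+1%:R / n.+1%:R <= x).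
    by apply/idP/idP; rewrite /st inE/= in_itv/= andbT.
  have -> : 2 * M * j.+1%:R / n.+1%:R = j.+1%:R * c n.
    by rewrite /c mulrAC [LHS]mulrC.
  by rewrite ler_pdivlMr//; apply/idP/idP; lra.
have ccvg : c n @[n --> \oo] --> (0 : R).
  rewrite -(mulr0 (2 * M)); apply: cvgM; first exact: cvg_cst.
  exact: cvg_harmonic.
have iid : mu.-integrable S (EFin \o (fun x : T => (x : R))) by exact: intS.
have I1 : \int[mu]_(x in S) s n x @[n --> \oo] --> \int[mu]_(x in S) (x : R).
  have cm : c n * fine (mu S) @[n --> \oo] --> (0 : R).
    by rewrite -(mul0r (fine (mu S))); apply: cvgM => //; exact: cvg_cst.
  apply/cvgrPdist_le => eps eps0.
  move/cvgr0Pnorm_le/(_ _ eps0): cm; apply: filterS => n cn.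
  have [bs _ _] := Ps n; have its := iP _ bs.
  have xs (x : T) : S x -> `|(x : R) - s n x| <= c n.
    by move=> Sx; apply: sx; move: Sx; rewrite /S/= in_itv.
  have id : mu.-integrable S (EFin \o (fun x : T => (x : R) - s n x)).
    apply: intS; last by exists (c n).
    by apply: measurable_funB => //; exact: bs.1.
  rewrite -RintegralB//; apply: le_trans (le_normr_Rintegral _ _) _ => //.
  apply: le_trans (_ : c n * fine (mu S) <= _); last by apply: le_trans cn; exact: ler_norm.
  rewrite -Rintegral_cst//; apply: le_Rintegral => //.
  - exact: (integrable_norm id).
  - exact: iP (bm_cst (c n)).
have I2 : \int[mu]_(x in S) s n x @[n --> \oo] --> formC psi F.
  rewrite (_ : (fun n => _) = fun n => formC psi (s n \o F)); last first.
    by apply/funext => n; have [_ _ ->] := Ps n.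
  apply: (formC_cvg (M := M + 2 * M)) => // [n||n x _|x _].
  - by have [] := Ps n.
  - exact: mF.1.
  - have cM : c n <= 2 * M.
      by rewrite ler_pdivrMr// ler_peMr// ?mulr_ge0 ?(ltW M0)// ler1n.
    have := sx n _ (FM x); have := FM x; rewrite /= !ler_norml.
    by set t := s n (F x); move: t cM => t; lra.
  - apply/cvgrPdist_le => eps eps0.
    move/cvgr0Pnorm_le/(_ _ eps0): ccvg; apply: filterS => n cn.
    by apply: le_trans (sx n _ (FM x)) _; apply: le_trans cn; exact: ler_norm.
exact: (cvg_unique _ I1 I2).
Qed.

(** The last two hypotheses say that the image of Lebesgue measure on [[0, 1]] under [F] has no
    atoms and is carried by a null set; [formC_ae0] transfers both properties to every spectral
    measure. *)
Lemma multiplication_purely_singular_continuous H :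
  (forall psi, ell2 psi -> H psi = operC F psi) ->
  (forall c, exists N : set T, [/\ measurable N, lebesgue_measure N = 0%E &
     forall x, 0 <= x <= 1 -> F x = c -> N x]) ->
  (exists Z N : set T, [/\ measurable Z, lebesgue_measure Z = 0%E, measurable N,
     lebesgue_measure N = 0%E & forall x, 0 <= x <= 1 -> ~ N x -> Z (F x)]) ->
  purely_singular_continuous_spectrum H.
Proof.
move=> HF atomless [Z [N [mZ Z0 mN N0 NZ]]].
have [[lO linO] symO] := operC_selfadjoint mF.1.
split.
  split; first split.
  - by move=> psi lp; rewrite HF//; exact: lO.
  - move=> a phi psi lp ls; rewrite (HF _ (ell2_lin a lp ls)) (HF _ lp) (HF _ ls).
    exact: linO.
  - by move=> phi psi lp ls; rewrite (HF _ lp) (HF _ ls); exact: symO.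
exists spectral_family; split.
  split; first exact: spectral_family_pvm.
  move=> psi mu lp muE; have [int2 int1] := spectral_family_integral lp muE.
  by split=> //; rewrite HF// int1; exact: inner_operC mF.1 lp.
move=> psi mu lp muE; split.
  move=> c; rewrite (scalar_measureE lp muE)//.
  have [N' [mN' N'0 FN']] := atomless c.
  rewrite (formC_ae0 psi (bA (measurable_set1 c)) mN' N'0)// => x x01 N'x.
  by rewrite indicE memNset//= => Fx; apply: N'x; exact: FN'.
exists Z; split=> //.
rewrite (scalar_measureE lp muE); last exact: measurableC.
rewrite (formC_ae0 psi (bA (measurableC mZ)) mN N0)// => x x01 Nx.
by rewrite indicE memNset//= => nZ; apply: nZ; exact: NZ.
Qed.

End SpectralTheorem.

(** * The symbol of the graph *)

Section Hartley.
Variable R : realType.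
Implicit Types (x y c : R) (n m k : int).

Definition tau : R := pi *+ 2.

Lemma tauE : tau = 2 * pi.
Proof. by rewrite /tau mulr_natl. Qed.

Definition hartley n x : R := cos (n%:~R * (tau * x)) + sin (n%:~R * (tau * x)).

Lemma cos_period x k : cos (x + k%:~R * tau) = cos x.
Proof.
case: k => k; first by rewrite -pmulrn mulr_natl (periodicn (@cosD2pi R)).
rewrite NegzE mulrNz mulNr -[in RHS](subrK (k.+1%:R * tau) x) -pmulrn.
by rewrite !mulr_natl [RHS](periodicn (@cosD2pi R)).
Qed.

Lemma sin_period x k : sin (x + k%:~R * tau) = sin x.
Proof.
case: k => k; first by rewrite -pmulrn mulr_natl (periodicn (@sinD2pi R)).
rewrite NegzE mulrNz mulNr -[in RHS](subrK (k.+1%:R * tau) x) -pmulrn.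
by rewrite !mulr_natl [RHS](periodicn (@sinD2pi R)).
Qed.

Lemma is_derive_sinM c x : is_derive x 1 (fun y => sin (c * y)) (c * cos (c * x)).
Proof.
rewrite mulrC; apply: (@is_derive1_comp R sin (fun y => c * y)).
by apply: is_derive_eq; rewrite [LHS]mulr1.
Qed.

Lemma is_derive_cosM c x : is_derive x 1 (fun y => cos (c * y)) (- (c * sin (c * x))).
Proof.
rewrite mulrC -mulNr; apply: (@is_derive1_comp R cos (fun y => c * y)).
by apply: is_derive_eq; rewrite [LHS]mulr1.
Qed.

Lemma continuous_cosM c : continuous (fun x => cos (c * x)).
Proof.
move=> x; apply: continuous_comp; last exact: continuous_cos.
exact: mulrl_continuous.
Qed.

Lemma continuous_sinM c : continuous (fun x => sin (c * x)).
Proof.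
move=> x; apply: continuous_comp; last exact: continuous_sin.
exact: mulrl_continuous.
Qed.

Lemma bm_cosM c : bm (fun x => cos (c * x)).
Proof.
split; first by apply: continuous_measurable_fun; exact: continuous_cosM.
by exists 1 => x; exact: cos_max.
Qed.

Lemma bm_sinM c : bm (fun x => sin (c * x)).
Proof.
split; first by apply: continuous_measurable_fun; exact: continuous_sinM.
by exists 1 => x; exact: sin_max.
Qed.

Lemma I01_continuous_FTC (g G : R -> R) : continuous g ->
  (forall x, is_derive x 1 G (g x)) -> I01 g = G 1 - G 0.
Proof.
move=> cg dG.
have cG : continuous G.
  by move=> x; apply/differentiable_continuous/derivable1_diffP; exact: ex_derive.
rewrite /I01 /Rintegral (@continuous_FTC2 R g G 0 1)//.
- exact: continuous_subspaceT.
- split=> [x _||]; first exact: ex_derive.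
  + by apply: cvg_at_right_filter; exact: cG.
  + by apply: cvg_at_left_filter; exact: cG.
- by move=> x _; have d := dG x; rewrite derive1E derive_val.
Qed.

Lemma I01_cos k : I01 (fun x => cos (k%:~R * tau * x)) = (k == 0)%:R.
Proof.
have [->|k0] := eqVneq k 0.
  by under eq_fun do rewrite !mul0r cos0; exact: I01_cst.
set c := k%:~R * tau.
have c0 : c != 0 by rewrite mulf_neq0 ?intr_eq0// mulrn_eq0/= gt_eqF ?pi_gt0.
have dG x : is_derive x 1 (fun y => c^-1 * sin (c * y)) (cos (c * x)).
  have ds := is_derive_sinM c x; apply: is_derive_eq.
  by rewrite [LHS]mulrA mulVf ?mul1r.
rewrite (I01_continuous_FTC (@continuous_cosM c) dG).
by rewrite mulr0 sin0 mulr0 subr0 mulr1 -[c]add0r sin_period sin0 mulr0.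
Qed.

Lemma I01_sin k : I01 (fun x => sin (k%:~R * tau * x)) = 0.
Proof.
have [->|k0] := eqVneq k 0.
  by under eq_fun do rewrite !mul0r sin0; exact: I01_cst.
set c := k%:~R * tau.
have c0 : c != 0 by rewrite mulf_neq0 ?intr_eq0// mulrn_eq0/= gt_eqF ?pi_gt0.
have dG x : is_derive x 1 (fun y => - c^-1 * cos (c * y)) (sin (c * x)).
  have ds := is_derive_cosM c x; apply: is_derive_eq.
  by rewrite [LHS]mulrNN mulrA mulVf ?mul1r.
rewrite (I01_continuous_FTC (@continuous_sinM c) dG).
by rewrite mulr0 cos0 mulr1 -[c in cos c]add0r cos_period cos0 mulr1 subrr.
Qed.

Lemma norm_hartley n x : `|hartley n x| <= 2.
Proof.
by apply: le_trans (ler_normD _ _) _; apply: lerD; [exact: cos_max|exact: sin_max].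
Qed.

Lemma bm_hartley n : bm (hartley n).
Proof.
rewrite /hartley; under eq_fun do rewrite mulrA.
by apply: bmD; [exact: bm_cosM|exact: bm_sinM].
Qed.

(** The product is the cosine of the difference frequency plus the sine of the sum frequency, and
    the sine always integrates to 0. *)
Lemma hartley_orth n m : I01 (fun x => hartley n x * hartley m x) = (n == m)%:R.
Proof.
have -> : (fun x => hartley n x * hartley m x) =
    (fun x => cos ((n - m)%:~R * tau * x) + sin ((n + m)%:~R * tau * x)).
  apply/funext => x; rewrite /hartley.
  have -> : (n - m)%:~R * tau * x = n%:~R * (tau * x) - m%:~R * (tau * x).
    by rewrite rmorphB/=; ring.
  have -> : (n + m)%:~R * tau * x = n%:~R * (tau * x) + m%:~R * (tau * x).
    by rewrite rmorphD/=; ring.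
  by rewrite cosB sinD; ring.
rewrite I01D; [|exact: bm_cosM|exact: bm_sinM].
by rewrite I01_cos I01_sin addr0 subr_eq0.
Qed.

(** Averaging the shifts by [k] and [- k] cancels every term with the sine of frequency [k], so in
    this real basis too a cosine acts as a symmetric shift. *)
Lemma cosM_hartley k n x : cos (k%:~R * (tau * x)) * hartley n x =
  2^-1 * (hartley (n + k) x + hartley (n - k) x).
Proof.
by rewrite /hartley !rmorphD rmorphN/= !mulrDl mulNr cosB sinB cosD sinD; field.
Qed.

End Hartley.

(** * The symbol as a lacunary cosine series *)

Section LacunarySeries.
Variable R : realType.
Implicit Types (x y : R) (n m k : int) (i j N M : nat).
Local Notation tau := (@tau R).
Local Notation hartley := (@hartley R).

(* [wt i] is the weight of [2 ^ i]. *)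
Definition wt i : R := (2 ^+ i.+2 * Num.sqrt i.+1%:R)^-1.

(** The factor 2 accounts for the equal weights at [2 ^ i] and [- 2 ^ i]. *)
Definition trig_sum N x : R := \sum_(0 <= i < N) 2 * wt i * cos (2 ^+ i * (tau * x)).

Definition symbol x : R := limn (trig_sum ^~ x).

Lemma wt_gt0 i : 0 < wt i.
Proof. by rewrite invr_gt0 mulr_gt0 ?exprn_gt0// sqrtr_gt0. Qed.

(** The sum telescopes: [2 * wt i] is [2 ^- i - 2 ^- (i + 1)] divided by the root of [i + 1], which
    is at least the root of [N + 1]. *)
Lemma wt_tail N M : (N <= M)%N ->
  \sum_(N <= i < M) 2 * wt i <= (2^-1 ^+ N - 2^-1 ^+ M) / Num.sqrt N.+1%:R.
Proof.
elim: M => [|M IH]; first by rewrite leqn0 => /eqP ->; rewrite big_geq// subrr mul0r.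
rewrite leq_eqVlt => /predU1P[->|]; first by rewrite big_geq// subrr mul0r.
rewrite ltnS => NM; rewrite big_nat_recr//=.
apply: le_trans (lerD (IH NM) (_ : _ <= (2^-1 ^+ M - 2^-1 ^+ M.+1) / Num.sqrt N.+1%:R)) _.
  have -> : 2 * wt M = (2^-1 ^+ M - 2^-1 ^+ M.+1) / Num.sqrt M.+1%:R.
    rewrite /wt !exprS !exprVn; field.
    by rewrite expf_neq0// gt_eqF ?sqrtr_gt0.
  apply: ler_wpM2l.
    by rewrite exprS subr_ge0 ler_piMl ?exprn_ge0// invf_le1// ler1n.
  by rewrite lef_pV2 ?posrE ?sqrtr_gt0//; apply: ler_wsqrtr; rewrite ler_nat; lia.
by rewrite -mulrDl addrA subrK.
Qed.

Lemma wt_tail_le N M : (N <= M)%N ->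
  \sum_(N <= i < M) 2 * wt i <= 2^-1 ^+ N / Num.sqrt N.+1%:R.
Proof.
move=> NM; apply: le_trans (wt_tail NM) _; apply: ler_wpM2r.
  by rewrite invr_ge0 sqrtr_ge0.
by rewrite lerBlDr lerDl exprn_ge0.
Qed.

Lemma trig_sum_dist N M x : (N <= M)%N ->
  `|trig_sum M x - trig_sum N x| <= 2^-1 ^+ N / Num.sqrt N.+1%:R.
Proof.
move=> NM; apply: le_trans (wt_tail_le NM).
rewrite /trig_sum (big_cat_nat (leq0n N) NM)/= addrAC subrr add0r.
apply: le_trans (ler_norm_sum _ _ _) _; apply: ler_sum => i _.
rewrite normrM ger0_norm; last by rewrite mulr_ge0// ltW// wt_gt0.
by rewrite ler_piMr ?cos_max// mulr_ge0// ltW// wt_gt0.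
Qed.

(** The series is the difference of two series with nonnegative terms and bounded partial sums, the
    first obtained by adding 1 to each cosine. *)
Lemma trig_sum_cvg x : trig_sum N x @[N --> \oo] --> symbol x.
Proof.
pose s N := \sum_(0 <= i < N) 2 * wt i.
pose t N := \sum_(0 <= i < N) 2 * wt i * (1 + cos (2 ^+ i * (tau * x))).
have s1 N : s N <= 1.
  by apply: le_trans (wt_tail_le (leq0n N)) _; rewrite expr0 sqrtr1 invr1 mulr1.
have cs : cvgn s.
  apply: nondecreasing_is_cvgn; last by exists 1 => _ [N _ <-].
  apply/nondecreasing_seqP => N; rewrite /s big_nat_recr//= lerDl.
  by rewrite mulr_ge0// ltW// wt_gt0.
have ct : cvgn t.
  apply: nondecreasing_is_cvgn; last first.
    exists 2 => _ [N _ <-]; apply: le_trans (_ : 2 * s N <= _).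
      rewrite /s mulr_sumr; apply: ler_sum => i _; rewrite mulrC ler_wpM2r//.
        by rewrite mulr_ge0// ltW// wt_gt0.
      by have := cos_le1 (2 ^+ i * (tau * x)); lra.
    by have := s1 N; lra.
  apply/nondecreasing_seqP => N; rewrite /t big_nat_recr//= lerDl.
  by rewrite mulr_ge0// mulr_ge0// ltW// wt_gt0.
have : cvgn (t \- s) by exact: is_cvgB.
suff -> : t \- s = trig_sum ^~ x by [].
apply/funext => N; rewrite /t /s/= -sumrB; apply: eq_bigr => i _; ring.
Qed.

Lemma symbol_dist N x : `|symbol x - trig_sum N x| <= 2^-1 ^+ N / Num.sqrt N.+1%:R.
Proof.
have c : `|trig_sum M x - trig_sum N x| @[M --> \oo] --> `|symbol x - trig_sum N x|.
  by apply: cvg_norm; apply: cvgB; [exact: trig_sum_cvg|exact: cvg_cst].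
by apply: (cvgr_to_le c); exists N => // M /= NM; exact: trig_sum_dist.
Qed.

Lemma symbol_dist_half N x : `|symbol x - trig_sum N x| <= 2^-1 ^+ N.
Proof.
apply: le_trans (symbol_dist N x) _; rewrite ler_piMr ?exprn_ge0//.
by rewrite invf_le1 ?sqrtr_gt0// -{1}sqrtr1 ler_wsqrtr// ler1n.
Qed.

Lemma bm_trig_term i : bm (fun x => 2 * wt i * cos (2 ^+ i * (tau * x))).
Proof.
under eq_fun do rewrite [2 ^+ i * _]mulrA.
by apply: bmZ; exact: bm_cosM.
Qed.

Lemma bm_trig_sum N : bm (trig_sum N).
Proof. by apply: bm_sum => i; exact: bm_trig_term. Qed.

Lemma bm_symbol : bm symbol.
Proof.
split.
  apply: (measurable_fun_cvg (h := trig_sum)) => [N|x _]; first exact: (bm_trig_sum N).1.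
  exact: trig_sum_cvg.
exists 1 => x; have := symbol_dist_half 0 x.
by rewrite /trig_sum big_geq// subr0 expr0.
Qed.

Lemma half_cvg0 : (2^-1 : R) ^+ N @[N --> \oo] --> (0 : R).
Proof. by apply: cvg_expr; rewrite ger0_norm ?invf_lt1 ?ltr1n. Qed.

Lemma trig_sum_hartley N n x : trig_sum N x * hartley n x =
  \sum_(0 <= i < N) wt i * (hartley (n + (2 ^ i)%N%:Z) x + hartley (n - (2 ^ i)%N%:Z) x).
Proof.
rewrite /trig_sum mulr_suml; apply: eq_bigr => i _.
rewrite -mulrA (_ : 2 ^+ i = (2 ^ i)%N%:Z%:~R); last by rewrite -pmulrn natrX.
by rewrite cosM_hartley; field.
Qed.

(** Each [trig_sum N * hartley n] is a finite combination of Hartley functions and approximates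
    [symbol * hartley n] uniformly within [2 * 2 ^- N]. *)
Lemma multiplier_symbol : multiplier hartley symbol.
Proof.
split=> [|n]; first exact: bm_symbol.
have bh := @bm_hartley R.
have be k : approximable hartley (hartley k) by exact: approximable_e.
apply: (approximable_lim bh) => [|eps eps0]; first exact: bmM bm_symbol _.
have [N _ /(_ N (leqnn N)) HN] : \forall N \near \oo, (2 * (2^-1 : R) ^+ N) ^+ 2 <= eps.
  have c : (2 * (2^-1 : R) ^+ N) ^+ 2 @[N --> \oo] --> (0 : R).
    have -> : (0 : R) = (2 * 0) * (2 * 0) by rewrite !mulr0.
    under eq_fun do rewrite expr2.
    by apply: cvgM; (apply: cvgM; [exact: cvg_cst|exact: half_cvg0]).
  move/cvgr0Pnorm_le/(_ _ eps0): c; apply: filterS => N; apply: le_trans.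
  exact: ler_norm.
exists (fun x => trig_sum N x * hartley n x); split.
- exact: bmM (bm_trig_sum N) _.
- pose S N x := \sum_(0 <= i < N) wt i *
    (hartley (n + (2 ^ i)%N%:Z) x + hartley (n - (2 ^ i)%N%:Z) x).
  rewrite (_ : (fun x => _) = S N); last first.
    by apply/funext => x; rewrite trig_sum_hartley.
  elim: N {HN} => [|N IH].
    rewrite (_ : S 0%N = (fun x => 0 * hartley 0 x)); first exact: (approximableZ bh).
    by apply/funext => x; rewrite /S big_geq// mul0r.
  have bs : bm (S N) by apply: bm_sum => i; apply: bmZ; exact: bmD.
  pose t x := wt N * (hartley (n + (2 ^ N)%N%:Z) x + hartley (n - (2 ^ N)%N%:Z) x).
  have bt : bm t by apply: bmZ; exact: bmD.
  rewrite (_ : S N.+1 = (fun x => S N x + t x)).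
    apply: (approximableD bh bs bt IH); apply: (approximableZ bh); first exact: bmD.
    exact: (approximableD bh).
  by apply/funext => x; rewrite /S big_nat_recr.
- apply: le_trans HN; rewrite -[leRHS]I01_cst; apply: I01_le => [||x _].
  + by apply: bmX; apply: bmB; apply: bmM => //; [exact: bm_symbol|exact: bm_trig_sum].
  + exact: bm_cst.
  rewrite -mulrBl -(real_normK (num_real (_ * _))) lerXn2r ?nnegrE//.
  rewrite normrM mulrC; apply: ler_pM => //; [exact: norm_hartley|exact: symbol_dist_half].
Qed.

Lemma weight_nat_pow i : weight_nat R (2 ^ i) = wt i.
Proof.
rewrite /weight_nat asboolT; last by exists i.+1; rewrite subn1.
have -> : 2 * (2 ^ i)%:R = 2 ^+ i.+1 :> R by rewrite exprS natrX.
rewrite /log2 lnXn// -[ln 2 *+ _]mulr_natl mulfK; last by rewrite gt_eqF// ln_gt0// ltr1n.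
by rewrite /wt natrX !exprS; congr (_ * _)^-1; ring.
Qed.

Lemma weight_nat_npow (k : nat) : (forall i, k != (2 ^ i)%N) -> weight_nat R k = 0.
Proof.
move=> kn; rewrite /weight_nat asboolF// => -[n [_ kE]].
by have := kn (n - 1)%N; rewrite kE eqxx.
Qed.

(** Turns the case distinction into a sum to be matched with [kernel_trig_sum]. Indices below [N]
    suffice because [2 ^ i <= N] forces [i < N]. *)
Lemma weight_nat_sum N (k : nat) : (k <= N)%N ->
  weight_nat R k = \sum_(0 <= i < N) wt i * (k == 2 ^ i)%N%:R.
Proof.
move=> kN; have [[i kE]|nk] := pselect (exists i, k = (2 ^ i)%N); last first.
  rewrite weight_nat_npow; last by move=> i; apply/eqP => kE; apply: nk; exists i.
  rewrite big1// => i _; case: eqP => [kE|_]; last by rewrite mulr0.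
  by case: nk; exists i.
have iN : (i < N)%N by apply: leq_trans kN; rewrite kE ltn_expl.
rewrite kE weight_nat_pow big_mkord (bigD1 (Ordinal iN))//= eqxx mulr1.
rewrite big1 ?addr0// => j ji; rewrite eqn_exp2l//.
rewrite (_ : (i == j :> nat) = false) ?mulr0//.
by apply: contraNF ji => /eqP ij; apply/eqP/val_inj.
Qed.

Lemma kernel_trig_sum N n m :
  kernel hartley (trig_sum N) n m = \sum_(0 <= i < N) wt i * (`|m - n|%N == 2 ^ i)%N%:R.
Proof.
have bh := @bm_hartley R.
pose S i x := wt i * (hartley (n + (2 ^ i)%N%:Z) x * hartley m x
                      + hartley (n - (2 ^ i)%N%:Z) x * hartley m x).
have bS i : bm (S i) by apply: bmZ; apply: bmD; exact: bmM.
rewrite /kernel (_ : (fun x => _) = (fun x => \sum_(0 <= i < N) S i x)); last first.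
  apply/funext => x; rewrite trig_sum_hartley mulr_suml.
  by apply: eq_bigr => i _; rewrite /S; ring.
rewrite I01_sum//; apply: eq_bigr => i _.
rewrite I01Z; last by apply: bmD; exact: bmM.
rewrite I01D; [|exact: bmM|exact: bmM]; rewrite !hartley_orth -natrD.
(* As [2 ^ i > 0], at most one of [n + 2 ^ i] and [n - 2 ^ i] equals [m]. *)
congr (_ * _%:R); have : (0 < 2 ^ i)%N by rewrite expn_gt0.
by set t := (2 ^ i)%N; case: eqP => ?; case: eqP => ?; case: eqP => ? //=; lia.
Qed.

(** The entries of the partial sums are constant from [N = |m - n|] on, and dominated convergence
    identifies their limit. *)
Lemma kernel_symbol n m : kernel hartley symbol n m = weight R (m - n).
Proof.
have bh := @bm_hartley R.
have c : kernel hartley (trig_sum N) n m @[N --> \oo] --> kernel hartley symbol n m.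
  apply: (I01_cvg (M := 2 * 2 * 2)) => [N||N x _|x _].
  - by apply: bm_kernel => //; exact: bm_trig_sum.
  - by apply: bm_kernel => //; exact: bm_symbol.
  - rewrite !normrM; apply: ler_pM => //; last exact: norm_hartley.
    rewrite -normrM; apply: le_trans (_ : 1 * 2 <= _); last lra.
    rewrite normrM; apply: ler_pM => //; last exact: norm_hartley.
    have := trig_sum_dist x (leq0n N).
    rewrite {2}/trig_sum big_geq// subr0 expr0 sqrtr1 divr1.
    by [].
  - by do 2 (apply: cvgM; last exact: cvg_cst); exact: trig_sum_cvg.
apply: (cvg_unique _ c) => //; apply: cvg_near_cst.
exists `|m - n|%N => // N /= nN.
by rewrite kernel_trig_sum /weight (weight_nat_sum nN).
Qed.

Lemma weight_ge0 k : 0 <= weight R k.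
Proof.
rewrite /weight (weight_nat_sum (leqnn _)); apply: sumr_ge0 => i _.
by rewrite mulr_ge0// ltW// wt_gt0.
Qed.

Lemma psum_weight_le N : psum N (weight R) <= 1.
Proof.
have H : psum N (weight R) <= \sum_(0 <= i < N) 2 * wt i.
  have -> : psum N (weight R) =
      psum N (fun k => \sum_(0 <= i < N) wt i * (`|k|%N == 2 ^ i)%N%:R).
    by apply: psum_eq_small => k kN; rewrite /weight (weight_nat_sum kN).
  rewrite /psum exchange_big/=; apply: ler_sum => i _.
  rewrite -mulr_sumr mulrC; apply: ler_wpM2r; first exact/ltW/wt_gt0.
  have t1 (m : int) : psum N (fun k => 1 * (k == m)%:R) <= 1 :> R.
    by rewrite psum_delta /trunc; case: ifP.
  rewrite [X in X <= _](_ : _ = psum N (fun k => (`|k|%N == 2 ^ i)%N%:R))//.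
  apply: le_trans (lerD (t1 (2 ^ i)%N%:Z) (t1 (- (2 ^ i)%N%:Z))).
  rewrite -psumD; apply: ler_psum => k; rewrite !mul1r -natrD ler_nat.
  by case: eqP => ?; case: eqP => ?; case: eqP => ? //; lia.
apply: le_trans H _; apply: le_trans (wt_tail_le (leq0n N)) _.
by rewrite expr0 sqrtr1 divr1.
Qed.

(** Row [n] of the matrix is [weight] centred at [n]; as the products vanish at both ends, the
    symmetric sum may be recentred there. *)
Lemma oper_symbol_cvg (a : int -> R) n : l2 a ->
  psum N (fun k => weight R k * a (n + k)) @[N --> \oo] --> oper hartley symbol a n.
Proof.
move=> la; have bh := @bm_hartley R; have ho := @hartley_orth R.
have lK := l2_kernel bh ho n bm_symbol.
pose g m := kernel hartley symbol n m * a m.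
have vg : vanishing g by apply: vanishingM; exact: l2_vanishing.
have := psum_shift_cvg n vg (dot_cvg lK la).
suff -> : (fun k => g (k + n)) = (fun k => weight R k * a (n + k)) by [].
by apply/funext => k; rewrite /g kernel_symbol addrK (addrC n).
Qed.

Local Open Scope complex_scope.

Lemma adjacency_operC (psi : int -> R[i]) : ell2 psi ->
  adjacency (@weight R) psi = operC hartley symbol psi.
Proof.
move=> /ell2P[lr li]; apply/funext => n; rewrite /adjacency /zsumC /operC.
congr (_ +i* _).
  rewrite -(cvg_zsum (oper_symbol_cvg (n := n) lr)); congr zsum; apply/funext => k.
  by rewrite /reseq; case: (psi _) => x y /=; rewrite mul0r subr0.
rewrite -(cvg_zsum (oper_symbol_cvg (n := n) li)); congr zsum; apply/funext => k.
by rewrite /imseq; case: (psi _) => x y /=; rewrite mul0r addr0.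
Qed.

Definition total_weight : R := zsum (@weight R).

Definition lap_symbol x : R := total_weight - symbol x.

Lemma laplacian_operC (psi : int -> R[i]) : ell2 psi ->
  laplacian (@weight R) psi = operC hartley lap_symbol psi.
Proof.
have bh := @bm_hartley R; have ho := @hartley_orth R.
have E a n : l2 a -> psum N (fun k => weight R k * (a n - a (n + k))) @[N --> \oo]
    --> oper hartley lap_symbol a n.
  move=> la.
  have -> : oper hartley lap_symbol a n = total_weight * a n - oper hartley symbol a n.
    rewrite (_ : lap_symbol = fun x => total_weight + (-1) * symbol x); last first.
      by apply/funext => x; rewrite mulN1r.
    rewrite (operDs bh ho (bm_cst _) (bmZ (-1) bm_symbol) la).
    by rewrite (oper_cst bh ho _ la) (operZs bh ho (-1) bm_symbol la) mulN1r.
  under eq_fun do (under eq_psum do rewrite mulrBr [weight R _ * a n]mulrC; rewrite psumB psumZ).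
  apply: cvgB; last exact: oper_symbol_cvg.
  rewrite mulrC; apply: cvgM; first exact: cvg_cst.
  exact: (ge0_psum_cvg weight_ge0 psum_weight_le).
move=> /ell2P[lr li]; apply/funext => n; rewrite /laplacian /zsumC /operC.
congr (_ +i* _).
  rewrite -(cvg_zsum (E _ n lr)); congr zsum; apply/funext => k.
  by rewrite /reseq; case: (psi n) (psi (n + k)) => ? ? [? ?] /=; rewrite mul0r subr0.
rewrite -(cvg_zsum (E _ n li)); congr zsum; apply/funext => k.
by rewrite /imseq; case: (psi n) (psi (n + k)) => ? ? [? ?] /=; rewrite mul0r addr0.
Qed.

Lemma multiplier_lap_symbol : multiplier hartley lap_symbol.
Proof.
apply: (multiplierB (@bm_hartley R)); last exact: multiplier_symbol.
exact: (multiplier_cst (@bm_hartley R)).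
Qed.

End LacunarySeries.

(** * Slopes and oscillation of the symbol *)

Section DyadicSums.
Variable R : realType.
Implicit Types (x y a h : R) (i j k n r : nat).
Local Notation tau := (@tau R).

Definition alpha i : R := (Num.sqrt i.+1%:R)^-1.

Lemma alpha_gt0 i : 0 < alpha i.
Proof. by rewrite invr_gt0 sqrtr_gt0. Qed.

Lemma alpha_le1 i : alpha i <= 1.
Proof. by rewrite invf_le1 ?sqrtr_gt0// -{1}sqrtr1 ler_wsqrtr// ler1n. Qed.

Lemma sqr_alpha i : alpha i ^+ 2 = i.+1%:R^-1.
Proof. by rewrite exprVn sqr_sqrtr. Qed.

Lemma wt_alpha i : 2 * wt R i * 2 ^+ i = 2^-1 * alpha i.
Proof.
rewrite /wt /alpha invfM !exprS; have : (2 : R) ^+ i != 0 by rewrite expf_neq0.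
have : Num.sqrt (i.+1%:R : R) != 0 by rewrite gt_eqF ?sqrtr_gt0.
set s := Num.sqrt _; set t := 2 ^+ i => s0 t0; field.
by rewrite s0.
Qed.

(** The quotient of consecutive [alpha] is at most the square root of 2, which is below [8/5]; this
    ratio is what the induction step of [alpha_geom] needs. *)
Lemma alphaS n : 5 * alpha n <= 8 * alpha n.+1.
Proof.
rewrite -ler_sqr ?nnegrE ?mulr_ge0 ?(ltW (alpha_gt0 _))//.
rewrite !exprMn !sqr_alpha -addn2 natrD -natr1.
have : 0 <= n%:R :> R by []; set m : R := n%:R => m0.
rewrite ler_pdivrMr; last lra.
by rewrite mulrAC ler_pdivlMr; lra.
Qed.

Lemma alpha_geom n : \sum_(0 <= i < n) 2 ^+ i * alpha i <= 4 * 2 ^+ n * alpha n.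
Proof.
elim: n => [|n IH]; first by rewrite big_geq// !mulr_ge0// ltW// alpha_gt0.
rewrite big_nat_recr//= exprS.
have t0 : 0 <= (2 : R) ^+ n by rewrite exprn_ge0.
by have := ler_wpM2l t0 (alphaS n); lra.
Qed.

Lemma MVT_le (f df : R -> R) x y : (forall z : R, is_derive z 1 f (df z)) -> x <= y ->
  exists2 c, x <= c <= y & f y - f x = df c * (y - x).
Proof.
move=> fdf xy; have [|c] := @MVT_segment R f df x y xy (fun z _ => fdf z).
  apply: continuous_subspaceT => z.
  by apply/differentiable_continuous/derivable1_diffP; exact: ex_derive.
by rewrite in_itv/= => cxy E; exists c.
Qed.

Lemma sin_lip x y : `|sin x - sin y| <= `|x - y|.
Proof.
wlog xy : x y / y <= x => [H|].
  by have [/H//|/ltW/H] := leP y x; rewrite distrC (distrC y).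
have [c _ ->] := MVT_le (@is_derive_sin R) xy.
by rewrite normrM ler_piMl// cos_max.
Qed.

Lemma cos_taylor x h : 0 <= h -> `|cos (x + h) - cos x + h * sin x| <= h ^+ 2.
Proof.
move=> h0; have xh : x <= x + h by rewrite lerDl.
have [c /andP[xc ch] ->] := MVT_le (@is_derive_cos R) xh.
have -> : - sin c * (x + h - x) + h * sin x = h * (sin x - sin c) by ring.
rewrite normrM ger0_norm// expr2 ler_wpM2l//.
apply: le_trans (sin_lip _ _) _; rewrite distrC ger0_norm ?subr_ge0//.
by rewrite lerBlDl.
Qed.

(** Up to the factor [- pi] this is the derivative of [trig_sum n], by [wt_alpha]. *)
Definition slope n x : R := \sum_(0 <= i < n) alpha i * sin (2 ^+ i * (tau * x)).

Lemma tau_gt0 : 0 < tau.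
Proof. by rewrite mulrn_wgt0// pi_gt0. Qed.

Lemma slope_lip n x h : 0 <= h ->
  `|slope n (x + h) - slope n x| <= tau * h * (4 * 2 ^+ n * alpha n).
Proof.
move=> h0; have th : 0 <= tau * h by rewrite mulr_ge0// ltW// tau_gt0.
apply: le_trans (ler_wpM2l th (alpha_geom n)).
rewrite /slope -sumrB mulr_sumr; apply: le_trans (ler_norm_sum _ _ _) _.
apply: ler_sum => i _; rewrite -mulrBr normrM gtr0_norm ?alpha_gt0//.
apply: le_trans (ler_wpM2l (ltW (alpha_gt0 i)) (sin_lip _ _)) _.
rewrite -mulrBr -mulrBr [x + h]addrC addrK ger0_norm ?mulr_ge0 ?exprn_ge0 ?(ltW tau_gt0)//.
by rewrite le_eqVlt; apply/orP; left; apply/eqP; ring.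
Qed.

(** Passing to either half of a dyadic interval adds one frequency, worth [alpha n], and moves the
    left end by at most half the length, worth [2 tau alpha n] by [slope_lip]. *)
Lemma slope_step n x :
  `|slope n.+1 (x + 2^-1 ^+ n.+1) - slope n x| <= (1 + 2 * tau) * alpha n /\
  `|slope n.+1 x - slope n x| <= (1 + 2 * tau) * alpha n.
Proof.
have a0 := alpha_gt0 n; have t0 := tau_gt0.
have S1 y : `|slope n.+1 y - slope n y| <= alpha n.
  rewrite /slope big_nat_recr//= addrAC subrr add0r normrM gtr0_norm//.
  by rewrite ler_piMr ?(ltW a0)// sin_max.
split; last first.
  by apply: le_trans (S1 x) _; rewrite ler_peMl ?(ltW a0)//; lra.
have h0 : 0 <= (2^-1 : R) ^+ n.+1 by rewrite exprn_ge0.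
have := slope_lip n x h0; rewrite exprS.
have -> : tau * (2^-1 * 2^-1 ^+ n) * (4 * 2 ^+ n * alpha n) =
    2 * tau * alpha n * (2^-1 ^+ n * 2 ^+ n) by field.
rewrite -exprMn mulVf// expr1n mulr1 -exprS => H.
have -> : slope n.+1 (x + 2^-1 ^+ n.+1) - slope n x =
  (slope n.+1 (x + 2^-1 ^+ n.+1) - slope n (x + 2^-1 ^+ n.+1))
  + (slope n (x + 2^-1 ^+ n.+1) - slope n x) by rewrite addrA subrK.
apply: le_trans (ler_normD _ _) _; rewrite mulrDl mul1r.
exact: lerD.
Qed.

(** The summands bound, in this order, the two tails of the series beyond [n], the linear term
    governed by the slope, and the second-order Taylor remainder. *)
Definition osc_cst : R := 2 + pi * (1 + 2 * tau) + 2 * tau ^+ 2.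

Lemma symbol_osc n a h : 0 <= h <= 2^-1 ^+ n ->
  `|slope n a| <= (1 + 2 * tau) * alpha n ->
  `|symbol (a + h) - symbol a| <= osc_cst * alpha n * 2^-1 ^+ n.
Proof.
move=> /andP[h0 hn] Sa; have t0 := tau_gt0; have a0 := alpha_gt0 n.
have d1 := symbol_dist n (a + h); have d2 := symbol_dist n a.
rewrite -/(alpha n) in d1 d2; set q := 2^-1 ^+ n in hn d1 d2 *.
pose b i := 2 ^+ i * (tau * h).
have b0 i : 0 <= b i by rewrite mulr_ge0 ?exprn_ge0// mulr_ge0// ltW.
pose rem := \sum_(0 <= i < n) 2 * wt R i *
  (cos (2 ^+ i * (tau * a) + b i) - cos (2 ^+ i * (tau * a)) + b i * sin (2 ^+ i * (tau * a))).
(* First-order expansion at [a]: the linear terms assemble into [slope n a], the Taylor remainders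
   into [rem]. *)
have E : trig_sum n (a + h) - trig_sum n a = rem - 2^-1 * (tau * h) * slope n a.
  rewrite /trig_sum /rem /slope mulr_sumr -!sumrB; apply: eq_bigr => i _.
  have -> : 2 ^+ i * (tau * (a + h)) = 2 ^+ i * (tau * a) + b i by rewrite /b; ring.
  set s := sin _; set c := cos _; set c' := cos _.
  have -> : 2^-1 * (tau * h) * (alpha i * s) = (2^-1 * alpha i) * (tau * h) * s by ring.
  rewrite -wt_alpha /b; ring.
have Rb : `|rem| <= 2 * tau ^+ 2 * alpha n * q.
  apply: le_trans (_ : \sum_(0 <= i < n) 2^-1 * (tau * h) ^+ 2 * (2 ^+ i * alpha i) <= _).
    apply: le_trans (ler_norm_sum _ _ _) _; apply: ler_sum => i _.
    have w0 : 0 <= 2 * wt R i by rewrite mulr_ge0// ltW// wt_gt0.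
    rewrite normrM ger0_norm//; apply: le_trans (ler_wpM2l w0 (cos_taylor _ (b0 i))) _.
    have -> : 2 * wt R i * b i ^+ 2 = (2 * wt R i * 2 ^+ i) * (2 ^+ i * (tau * h) ^+ 2).
      by rewrite /b; ring.
    by rewrite wt_alpha le_eqVlt; apply/orP; left; apply/eqP; ring.
  rewrite -mulr_sumr -mulrA.
  have q1 : 0 <= 2^-1 * (tau * h) ^+ 2 by rewrite mulr_ge0// sqr_ge0.
  rewrite mulrA; apply: le_trans (ler_wpM2l q1 (alpha_geom n)) _.
  have q0 : 0 <= q by rewrite exprn_ge0.
  have hq : h ^+ 2 <= q ^+ 2 by rewrite lerXn2r ?nnegrE.
  have c0 : 0 <= 2^-1 * tau ^+ 2 * (4 * 2 ^+ n * alpha n).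
    by rewrite mulr_ge0 ?mulr_ge0 ?sqr_ge0 ?exprn_ge0// ltW.
  have := ler_wpM2l c0 hq; rewrite /q.
  have -> : 2^-1 * tau ^+ 2 * (4 * 2 ^+ n * alpha n) * (2^-1 ^+ n) ^+ 2 =
      2 * tau ^+ 2 * alpha n * 2^-1 ^+ n * (2^-1 ^+ n * 2 ^+ n) by field.
  rewrite -[in X in _ <= X -> _]exprMn mulVf// expr1n mulr1; apply: le_trans.
  by rewrite le_eqVlt; apply/orP; left; apply/eqP; ring.
have Lb : `|2^-1 * (tau * h) * slope n a| <= pi * (1 + 2 * tau) * alpha n * q.
  rewrite normrM ger0_norm; last by rewrite !mulr_ge0// ltW.
  have -> : 2^-1 * (tau * h) = pi * h by rewrite tauE; field.
  have p0 : 0 <= pi * h by rewrite mulr_ge0// ltW// pi_gt0.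
  apply: le_trans (ler_wpM2l p0 Sa) _.
  have c0 : 0 <= pi * ((1 + 2 * tau) * alpha n).
    by rewrite mulr_ge0 ?ltW ?pi_gt0// mulr_gt0//; lra.
  by have := ler_wpM2l c0 hn; lra.
have -> : symbol (a + h) - symbol a = (symbol (a + h) - trig_sum n (a + h))
    + ((rem - 2^-1 * (tau * h) * slope n a) - (symbol a - trig_sum n a)).
  by rewrite -E; ring.
apply: le_trans (ler_normD _ _) _.
apply: le_trans (lerD d1 (le_trans (ler_normB _ _) (lerD (le_trans (ler_normB _ _) (lerD Rb Lb)) d2))) _.
by rewrite le_eqVlt; apply/orP; left; apply/eqP; rewrite /osc_cst; ring.
Qed.

End DyadicSums.

(** * Moments and tails of slope increments over dyadic points *)

Section RandomDyadicSums.
Variable R : realType.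
Implicit Types (x y a h : R) (i j k n r : nat).
Local Notation tau := (@tau R).
Local Notation alpha := (@alpha R).
Local Notation slope := (@slope R).

(* The part of [slope (n + k)] coming from the frequencies [2 ^ n] and above,
   at the [r]-th of the [2 ^ k] equidistant points of a dyadic interval of
   length [2 ^ - n]. *)
Definition incr n k r : R :=
  \sum_(0 <= i < k) alpha (n + i) * sin (2 ^+ i * (tau * (r%:R / 2 ^+ k))).

Lemma sum_split_pow2 k (F : nat -> R) :
  \sum_(0 <= r < 2 ^ k.+1) F r = \sum_(0 <= r < 2 ^ k) (F r + F (r + 2 ^ k)%N).
Proof.
rewrite expnS mul2n -addnn (big_cat_nat (leq0n (2 ^ k)) (leq_addl _ _))/=.
rewrite big_split/=; congr (_ + _).
by rewrite -[X in index_iota X _]add0n big_addn addnK.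
Qed.

Lemma big_addl (F : nat -> R) n k :
  \sum_(n <= i < n + k) F i = \sum_(0 <= i < k) F (n + i)%N.
Proof.
rewrite -{1}(add0n n) big_addn addKn.
by apply: eq_bigr => i _; rewrite addnC.
Qed.

Lemma pow2_neq0 k : (2 : R) ^+ k != 0.
Proof. by rewrite expf_neq0. Qed.

Lemma sin_nat_period x n : sin (x + n%:R * tau) = sin x.
Proof. by rewrite pmulrn sin_period. Qed.

Lemma incrD n k r : incr n k (r + 2 ^ k) = incr n k r.
Proof.
apply: eq_bigr => i _; congr (_ * _).
rewrite -[RHS](sin_nat_period _ (2 ^ i)); congr sin.
by rewrite natrD !natrX; field; exact: pow2_neq0.
Qed.

Lemma incrS n k r :
  incr n k.+1 r = alpha n * sin (tau * (r%:R / 2 ^+ k.+1)) + incr n.+1 k r.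
Proof.
rewrite /incr big_nat_recl// addn0 expr0 mul1r; congr (_ + _).
apply: eq_bigr => i _; rewrite addnS; congr (_ * sin _).
by rewrite !exprS; field; exact: pow2_neq0.
Qed.

(** Shifting by half the points flips the lowest frequency and fixes all higher ones. The pairs [r],
    [r + 2 ^ k] thus carry [t + a s] and [t - a s], and odd mixed moments cancel as for independent
    random signs. *)
Lemma incrSD n k r : incr n k.+1 (r + 2 ^ k) =
  - (alpha n * sin (tau * (r%:R / 2 ^+ k.+1))) + incr n.+1 k r.
Proof.
rewrite incrS incrD -mulrN; congr (_ * _ + _).
have -> : tau * ((r + 2 ^ k)%:R / 2 ^+ k.+1) = tau * (r%:R / 2 ^+ k.+1) + pi.
  by rewrite natrD natrX tauE exprS; field; exact: pow2_neq0.
exact: sinDpi.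
Qed.

Lemma incr0 n k : incr n k 0 = 0.
Proof. by apply: big1 => i _; rewrite mul0r !mulr0 sin0 mulr0. Qed.

Lemma incr_rev n k r : (r <= 2 ^ k)%N -> incr n k (2 ^ k - r) = - incr n k r.
Proof.
move=> rk; rewrite /incr -sumrN; apply: eq_bigr => i _; rewrite -mulrN; congr (_ * _).
rewrite -sinN -(sin_nat_period (- _) (2 ^ i)); congr sin.
by rewrite natrB// !natrX; field; exact: pow2_neq0.
Qed.

Definition m2 n k := \sum_(0 <= r < 2 ^ k) incr n k r ^+ 2.
Definition m4 n k := \sum_(0 <= r < 2 ^ k) incr n k r ^+ 4.

Definition var n k : R := \sum_(0 <= i < k) alpha (n + i) ^+ 2 / 2.

(** The points [r] and [r + 2 ^ k] are a quarter turn apart, so their squared sines add up to 1. *)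
Lemma sin_sq_sum k :
  \sum_(0 <= r < 2 ^ k.+1) sin (tau * (r%:R / 2 ^+ k.+2)) ^+ 2 = 2 ^+ k.
Proof.
rewrite sum_split_pow2 (eq_bigr (fun=> 1)) => [|r _].
  by rewrite sumr_const_nat subn0 natrX.
have -> : tau * ((r + 2 ^ k)%:R / 2 ^+ k.+2) = tau * (r%:R / 2 ^+ k.+2) + pi / 2.
  by rewrite natrD natrX tauE !exprS; field; exact: pow2_neq0.
by rewrite sinDpihalf addrC cos2Dsin2.
Qed.

Lemma m2S n k : m2 n k.+1 = 2 * m2 n.+1 k +
  2 * alpha n ^+ 2 * \sum_(0 <= r < 2 ^ k) sin (tau * (r%:R / 2 ^+ k.+1)) ^+ 2.
Proof.
rewrite /m2 sum_split_pow2 !mulr_sumr -big_split/=; apply: eq_bigr => r _.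
rewrite incrS incrSD; set s := sin _; set t := incr _ _ _; set a := alpha n; ring.
Qed.

Lemma incr1 n r : (r < 2)%N -> incr n 1 r = 0.
Proof.
case: r => [|[|//]] _; first exact: incr0.
rewrite /incr big_nat1 expr0 mul1r expr1.
have -> : tau * (1 / 2) = pi by rewrite tauE; field.
by rewrite sinpi mulr0.
Qed.

(** Iterates the pairing of [m2S]. The top frequency vanishes at all sample points, as
    [sin (pi r) = 0], so [var] has one term fewer than [incr]. *)
Lemma m2E n k : m2 n k.+1 = 2 ^+ k.+1 * var n k.
Proof.
elim: k n => [|k IH] n.
  rewrite /var big_geq// mulr0 /m2 big_nat; apply: big1 => r /andP[_ r2].
  by rewrite incr1// expr0n.
rewrite m2S IH sin_sq_sum /var [in RHS]big_nat_recl// addn0.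
under [in RHS]eq_bigr do rewrite addnS.
by set S := \sum_(0 <= i < k) _; rewrite !exprS; field.
Qed.

(** In [(t + a s)^4 + (t - a s)^4] only even powers survive, and [s^2 <= 1] reduces them to the
    moments at level [n + 1]. The constant 6 comes from the mixed terms, whose contribution
    [6 a^2 v] is exactly that of [6 (v + a^2 / 2)^2]. *)
Lemma m4_le n k : m4 n k.+1 <= 2 ^+ k.+1 * (6 * var n k ^+ 2).
Proof.
elim: k n => [|k IH] n.
  rewrite /var big_geq// expr0n !mulr0 /m4 big_nat big1// => r /andP[_ r2].
  by rewrite incr1// expr0n.
have -> : var n k.+1 = alpha n ^+ 2 / 2 + var n.+1 k.
  rewrite /var big_nat_recl// addn0; congr (_ + _).
  by apply: eq_bigr => i _; rewrite addnS.
set a := alpha n; set v := var n.+1 k.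
have : m4 n k.+2 <= \sum_(0 <= r < 2 ^ k.+1) (2 * incr n.+1 k.+1 r ^+ 4
    + 12 * a ^+ 2 * incr n.+1 k.+1 r ^+ 2
    + 2 * a ^+ 4 * sin (tau * (r%:R / 2 ^+ k.+2)) ^+ 2).
  rewrite /m4 sum_split_pow2; apply: ler_sum => r _.
  rewrite incrS incrSD -/a; set s := sin _; set t := incr _ _ _.
  have s1 : s ^+ 2 <= 1 by rewrite -(cos2Dsin2 (tau * (r%:R / 2 ^+ k.+2))) lerDr sqr_ge0.
  have s0 : 0 <= s ^+ 2 by exact: sqr_ge0.
  rewrite -subr_ge0.
  have -> : 2 * t ^+ 4 + 12 * a ^+ 2 * t ^+ 2 + 2 * a ^+ 4 * s ^+ 2
      - ((a * s + t) ^+ 4 + (- (a * s) + t) ^+ 4) =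
      12 * (a * t) ^+ 2 * (1 - s ^+ 2) + 2 * (a ^+ 2) ^+ 2 * (s ^+ 2 * (1 - s ^+ 2)) by ring.
  have s2 : 0 <= 1 - s ^+ 2 by rewrite subr_ge0.
  have p1 : 0 <= 12 * (a * t) ^+ 2 by rewrite mulr_ge0 ?sqr_ge0.
  have p2 : 0 <= 2 * (a ^+ 2) ^+ 2 by rewrite mulr_ge0 ?sqr_ge0.
  exact: addr_ge0 (mulr_ge0 p1 s2) (mulr_ge0 p2 (mulr_ge0 s0 s2)).
rewrite !big_split/= -!mulr_sumr sin_sq_sum -/(m4 _ _) -/(m2 _ _) m2E -/v.
move=> /le_trans; apply; have := IH n.+1; rewrite -/v.
have : 0 <= (2 : R) ^+ k by rewrite exprn_ge0.
rewrite !exprS expr0 !mulr1 => t0 H.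
have a0 : 0 <= a * a * (a * a) by rewrite -expr2 sqr_ge0.
have := mulr_ge0 t0 a0; set t := 2 ^+ k in t0 H *; move: H; set m := m4 _ _.
lra.
Qed.

(* Paley-Zygmund, in the form [X^2 <= V/4 + 3 V 1_{X^2 > V/4} + X^4/(12 V)]. *)
Lemma incr_large n k : 0 < var n k ->
  2 ^+ k.+1 / 12 <= \sum_(0 <= r < 2 ^ k.+1) (var n k / 4 < incr n k.+1 r ^+ 2)%R%:R :> R.
Proof.
set V := var n k => V0.
have V12 : 0 <= (12 * V)^-1 by rewrite invr_ge0 mulr_ge0// ltW.
set P := \sum_(_ <= _ < _) _.
have : m2 n k.+1 <= \sum_(0 <= r < 2 ^ k.+1) (V / 4
    + 3 * V * (V / 4 < incr n k.+1 r ^+ 2)%R%:R + (12 * V)^-1 * incr n k.+1 r ^+ 4).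
  apply: ler_sum => r _; set t := incr _ _ _.
  have h : 0 <= (12 * V)^-1 * (t ^+ 2 - 6 * V) ^+ 2.
    by rewrite mulr_ge0 ?sqr_ge0// invr_ge0 mulr_ge0// ltW.
  have q : t ^+ 2 <= 3 * V + (12 * V)^-1 * t ^+ 4.
    rewrite -subr_ge0; apply: le_trans h _.
    by rewrite le_eqVlt; apply/orP; left; apply/eqP; field; rewrite gt_eqF.
  have [tV|tV] /= := ltP (V / 4) (t ^+ 2); first by rewrite mulr1; lra.
  rewrite mulr0 addr0; apply: le_trans tV _; rewrite lerDl.
  have t4 : 0 <= t ^+ 4 by rewrite (exprM t 2 2) sqr_ge0.
  exact: mulr_ge0 V12 t4.
rewrite !big_split/= -!mulr_sumr -/P -/(m4 _ _) sumr_const_nat subn0 -[_ *+ _]mulr_natr natrX.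
rewrite m2E -/V.
(* Of the mean [V], the parts [V / 4] and [V / 2] are used up; the remaining [V / 4] is at most
   [3 V] times the proportion sought, hence 1/12. *)
have := ler_wpM2l V12 (m4_le n k); rewrite -/V.
have -> : (12 * V)^-1 * (2 ^+ k.+1 * (6 * V ^+ 2)) = 2 ^+ k.+1 * (V / 2).
  by field; rewrite gt_eqF.
set M := (12 * V)^-1 * _; set t := 2 ^+ k.+1 => H1 H2.
have : V * (t / 12) <= V * P by lra.
by rewrite ler_pM2l.
Qed.

(** Reflecting [r] to [2 ^ k - r] changes the sign of [incr]. The point [r = 0], where [incr] is 0,
    is split off because its reflection is out of range. *)
Lemma incr_symmetric n k (c : R) :
  \sum_(0 <= r < 2 ^ k) (incr n k r < - c)%R%:R =
  \sum_(0 <= r < 2 ^ k) (c < incr n k r)%R%:R :> R.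
Proof.
have k0 : (0 < 2 ^ k)%N by rewrite expn_gt0.
rewrite !(big_ltn k0) incr0 oppr_gt0; congr (_ + _).
rewrite big_nat_rev [LHS]big_nat [RHS]big_nat/=; apply: eq_bigr => r /andP[r1 rk].
have -> : (1 + 2 ^ k - r.+1 = 2 ^ k - r)%N by lia.
by rewrite incr_rev ?(ltnW rk)// ltrN2.
Qed.

Lemma var_unbounded n (C : R) : exists k, C <= var n k.
Proof.
have hc := @dvg_harmonic R.
have nd : nondecreasing_seq (series (@harmonic R)).
  by apply/nondecreasing_seqP => m; rewrite /series/= big_nat_recr//= lerDl harmonic_ge0.
have /cvgryPge/(_ (2 * C + series harmonic n))[k _ /(_ (n + k)%N (leq_addl _ _))/=] :=
  nondecreasing_dvgn_lt nd hc.
rewrite /series/= (big_cat_nat (leq0n n) (leq_addr k n))/= => H; exists k.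
have -> : var n k = 2^-1 * \sum_(n <= i < n + k) harmonic i.
  rewrite big_addl mulr_sumr.
  by apply: eq_bigr => i _; rewrite sqr_alpha /= mulrC.
by move: H; set s := \sum_(_ <= _ < n) _; lra.
Qed.

(* Sums of [b%:R] count the points [r] where [b] holds.  By symmetry, each of the
   two tails has at least half of the proportion [1/12] found in [incr_large]. *)
Lemma incr_tail n : exists k, forall s : bool,
  \sum_(0 <= r < 2 ^ k) (- n%:R <= (-1) ^+ s * incr n k r)%R%:R <= 23 / 24 * 2 ^+ k :> R.
Proof.
(* The target [4 n^2 + 1] makes [var n k / 4 > n^2], so large increments exceed [n] in size, and
   keeps the variance positive for [n = 0]. *)
have [k Vk] := var_unbounded n (4 * n%:R ^+ 2 + 1); exists k.+1 => s.
have n0 : 0 <= (n%:R : R) ^+ 2 by exact: sqr_ge0.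
have V0 : 0 < var n k by lra.
pose c : R := n%:R; pose lo := \sum_(0 <= r < 2 ^ k.+1) (incr n k.+1 r < - c)%R%:R : R.
pose hi := \sum_(0 <= r < 2 ^ k.+1) (c < incr n k.+1 r)%R%:R : R.
have lohi : lo = hi by exact: incr_symmetric.
have : 2 ^+ k.+1 / 12 <= lo + hi.
  apply: le_trans (incr_large V0) _; rewrite -big_split/=; apply: ler_sum => r _.
  set t := incr _ _ _; have [tV|_] := ltP (var n k / 4) (t ^+ 2); last by rewrite addr_ge0.
  have : c ^+ 2 < t ^+ 2 by rewrite /c; lra.
  rewrite -(real_normK (num_real t)) ltr_sqr ?nnegrE// lter_normr.
  case/orP => [ct|ct]; first by rewrite ct lerDr.
  by rewrite ltrNr ct lerDl.
move=> H.
have -> : \sum_(0 <= r < 2 ^ k.+1) (- n%:R <= (-1) ^+ s * incr n k.+1 r)%R%:R =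
    2 ^+ k.+1 - (if s then hi else lo) :> R.
  have -> : 2 ^+ k.+1 = \sum_(0 <= r < 2 ^ k.+1) 1 :> R.
    by rewrite sumr_const_nat subn0 natrX.
  case: s; rewrite -sumrB; apply: eq_bigr => r _.
    by rewrite expr1 mulN1r lerN2 leNgt -/c; case: (c < _); rewrite /= ?subrr ?subr0.
  by rewrite expr0 mul1r leNgt -/c; case: (_ < - c); rewrite /= ?subrr ?subr0.
by case: s; lra.
Qed.

Lemma slope_bound n x : `|slope n x| <= n%:R.
Proof.
apply: le_trans (ler_norm_sum _ _ _) _.
apply: le_trans (_ : \sum_(0 <= i < n) 1 <= _); last by rewrite sumr_const_nat subn0.
apply: ler_sum => i _; rewrite normrM -[leRHS]mulr1; apply: ler_pM => //.
  by rewrite gtr0_norm ?alpha_gt0// alpha_le1.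
exact: sin_max.
Qed.

(** Frequencies from [2 ^ n] on have period [2 ^- n] and do not see the base point [j / 2 ^ n]. *)
Lemma slope_incr n k j r :
  slope (n + k) (j%:R / 2 ^+ n + r%:R / 2 ^+ (n + k)) =
  slope n (j%:R / 2 ^+ n + r%:R / 2 ^+ (n + k)) + incr n k r.
Proof.
rewrite {1}/slope (big_cat_nat (leq0n n) (leq_addr k n))/=; congr (_ + _).
rewrite big_addl; apply: eq_bigr => i _; congr (_ * _).
rewrite -(sin_nat_period (2 ^+ i * _) (2 ^ i * j)); congr sin.
by rewrite natrM natrX !exprD; field; rewrite !pow2_neq0.
Qed.

End RandomDyadicSums.

(** * Covering the image by dyadic intervals *)

Section DyadicTree.
Variable R : realType.
Local Notation leb := (@lebesgue_measure R).
Local Notation T := (measurableTypeR R).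
Implicit Types (x y a h : R) (i j k n r : nat).

Variables (g : R -> R) (eps : R).
Hypothesis eps0 : 0 < eps.
Hypothesis g_symbol : forall x y, `|g x - g y| = `|symbol x - symbol y|.

Local Notation q n := ((2^-1 : R) ^+ n).

Let q_gt0 n : 0 < q n. Proof. by rewrite exprn_gt0. Qed.

Let qS n : q n = q n.+1 + q n.+1.
Proof. by rewrite exprS; field. Qed.

Definition good n a := forall x, a <= x <= a + q n -> `|g x - g a| <= eps * q n.

(* [bad k n a] counts the dyadic intervals of length [2 ^ - (n + k)] inside
   [[a, a + 2 ^ - n]] having no good ancestor below that interval, [rest k n a]
   is their union, and [cov k n a] covers the image of the complement. *)
Fixpoint bad k n a : nat :=
  if `[< good n a >] then 0%N else
  if k is k'.+1 then (bad k' n.+1 a + bad k' n.+1 (a + q n.+1))%N else 1%N.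

Fixpoint rest k n a : set T :=
  if `[< good n a >] then set0 else
  if k is k'.+1 then rest k' n.+1 a `|` rest k' n.+1 (a + q n.+1)
  else `[a, a + q n]%classic.

Fixpoint cov k n a : set T :=
  if `[< good n a >] then `[g a - eps * q n, g a + eps * q n]%classic else
  if k is k'.+1 then cov k' n.+1 a `|` cov k' n.+1 (a + q n.+1) else set0.

Lemma measurable_rest k n a : measurable (rest k n a).
Proof.
elim: k n a => [|k IH] n a /=; (case: asboolP => _; first exact: measurable0).
  exact: measurable_itv.
exact: measurableU.
Qed.

Lemma measurable_cov k n a : measurable (cov k n a).
Proof.
elim: k n a => [|k IH] n a /=; (case: asboolP => _; first exact: measurable_itv).
  exact: measurable0.
exact: measurableU.
Qed.

Lemma lebesgue_cov k n a : (leb (cov k n a) <= (2 * eps * q n)%:E)%E.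
Proof.
have qe m : 0 <= 2 * eps * q m by rewrite !mulr_ge0// ltW.
have itv m b : (leb `[(g b - eps * q m)%R, (g b + eps * q m)%R] <= (2 * eps * q m)%:E)%E.
  rewrite lebesgue_measure_itv/=; case: ifP => _; last by rewrite lee_fin.
  by rewrite -EFinB lee_fin; lra.
elim: k n a => [|k IH] n a /=; case: asboolP => // _; first by rewrite measure0 lee_fin.
apply: le_trans (measureU2 _ (measurable_cov _ _ _) (measurable_cov _ _ _)) _.
by rewrite (qS n) mulrDr EFinD; exact: (leeD (IH _ _) (IH _ _)).
Qed.

Lemma lebesgue_rest k n a : (leb (rest k n a) <= ((bad k n a)%:R * q (n + k))%:E)%E.
Proof.
elim: k n a => [|k IH] n a /=; case: asboolP => _; rewrite ?measure0 ?mul0r ?lee_fin//.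
  rewrite lebesgue_measure_itv/= addn0 mul1r lte_fin ltrDl q_gt0 -EFinB lee_fin; lra.
apply: le_trans (measureU2 _ (measurable_rest _ _ _) (measurable_rest _ _ _)) _.
by rewrite natrD mulrDl EFinD addnS -addSn; exact: (leeD (IH _ _) (IH _ _)).
Qed.

Lemma cov_rest k n a x : a <= x <= a + q n -> ~ rest k n a x -> cov k n a (g x).
Proof.
have E m b y : good m b -> b <= y <= b + q m ->
    `[g b - eps * q m, g b + eps * q m]%classic (g y).
  by move=> gm bym; have := gm y bym; rewrite /= in_itv/= ler_distl.
elim: k n a => [|k IH] n a /= axn; case: asboolP => [/E/(_ axn)//|_]; rewrite ?in_itv//.
move=> /not_orP[r1 r2]; have := qS n => qn; have [xa|xa] := leP x (a + q n.+1).
  by left; apply: IH => //; lra.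
by right; apply: IH => //; lra.
Qed.

Lemma bad_le k n a : (bad k n a <= 2 ^ k)%N.
Proof.
elim: k n a => [|k IH] n a /=; case: asboolP => // _.
by rewrite expnS mul2n -addnn leq_add.
Qed.

Definition dyadic n a := exists j : nat, a = j%:R / 2 ^+ n.

Lemma dyadicS n a : dyadic n a -> dyadic n.+1 a /\ dyadic n.+1 (a + q n.+1).
Proof.
move=> [j ->]; split.
  by exists (j * 2)%N; rewrite natrM exprS; field; exact: pow2_neq0.
exists (j * 2 + 1)%N; rewrite exprVn natrD natrM !exprS; field.
exact: pow2_neq0.
Qed.

(** Each interval left after [k] subdivisions leaves at most [c] after [k'] more, and good intervals
    leave none. *)
Lemma bad_add k k' n a (c : R) : 0 <= c -> dyadic n a ->
  (forall b, dyadic (n + k) b -> (bad k' (n + k) b)%:R <= c) ->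
  (bad (k + k') n a)%:R <= (bad k n a)%:R * c.
Proof.
move=> c0; elim: k n a => [|k IH] n a da H /=.
  rewrite addn0 in H; case: asboolP => [ga|_]; last by rewrite mul1r H.
  by rewrite mul0r; case: k' H => [|k'] H /=; rewrite asboolT.
case: asboolP => [_|_]; first by rewrite mul0r.
rewrite addnS -addSn in H; have [d1 d2] := dyadicS da.
by rewrite !natrD mulrDl; apply: lerD; exact: IH.
Qed.

Section Crossing.
Variable n0 : nat.
Hypothesis osc_small : forall n, (n0 <= n)%N -> osc_cst R * alpha R n <= eps.

Lemma small_slope_good n a : (n0 <= n)%N ->
  `|slope n a| <= (1 + 2 * @tau R) * alpha R n -> good n a.
Proof.
move=> nn Sa x /andP[ax xn]; rewrite g_symbol.
have hn : 0 <= x - a <= q n by lra.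
have := symbol_osc hn Sa; rewrite (addrC a) subrK => /le_trans; apply.
by rewrite ler_wpM2r ?osc_small// ltW.
Qed.

(** An interval that is not good has slope beyond the threshold of [small_slope_good], which is also
    the largest change that [slope_step] allows in one subdivision. So the sign of the slope
    persists down every branch counted by [bad]. *)
Lemma bad_le_count (s : bool) k n a : (n0 <= n)%N -> 0 <= (-1) ^+ s * slope n a ->
  (bad k n a)%:R <= \sum_(0 <= r < 2 ^ k)
     (0 <= (-1) ^+ s * slope (n + k) (a + r%:R / 2 ^+ (n + k)))%R%:R :> R.
Proof.
move=> nn; elim: k n nn a => [|k IH] n nn a S0 /=; case: asboolP => ga;
  try by apply: sumr_ge0.
  by rewrite expn0 big_nat1 mul0r addr0 addn0 S0.
have Sa : (1 + 2 * @tau R) * alpha R n < (-1) ^+ s * slope n a.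
  rewrite ltNge; apply/negP => Sa; apply: ga; apply: small_slope_good => //.
  by rewrite -[slope n a]mul1r -(signrMK s (slope n a)) mul1r normrMsign ger0_norm.
have [st1 st2] := slope_step n a.
have key b : `|slope n.+1 b - slope n a| <= (1 + 2 * @tau R) * alpha R n ->
    0 <= (-1) ^+ s * slope n.+1 b.
  move=> H; have : `|(-1) ^+ s * (slope n.+1 b - slope n a)| <= (1 + 2 * @tau R) * alpha R n.
    by rewrite normrMsign.
  by rewrite mulrBr ler_norml; lra.
rewrite natrD sum_split_pow2 big_split/= addnS -addSn.
apply: lerD; first by apply: IH; [exact: leqW|exact: key].
apply: le_trans (IH _ (leqW nn) _ (key _ st1)) _.
rewrite le_eqVlt; apply/orP; left; apply/eqP; apply: eq_bigr => r _.
congr (nat_of_bool (0 <= _ * slope _ _))%:R.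
rewrite natrD natrX exprVn !exprD !exprS; field.
by rewrite !pow2_neq0.
Qed.

(** A counted interval keeps the initial sign of the slope. Frequencies below [2 ^ n] contribute at
    most [n], so its increment is at least [- n] in that direction, which fails for at least 1/24 of
    the points by [incr_tail]. The depth [k] is uniform in [a], so [bad_add] can iterate. *)
Lemma bad_ratio n : (n0 <= n)%N -> exists k, forall a, dyadic n a ->
  (bad k n a)%:R <= 23 / 24 * 2 ^+ k :> R.
Proof.
move=> nn; have [k Hk] := incr_tail R n; exists k => _ [j ->].
pose s : bool := slope n (j%:R / 2 ^+ n : R) < 0.
have S0 : 0 <= (-1) ^+ s * slope n (j%:R / 2 ^+ n : R) by rewrite -normrEsign.
apply: le_trans (bad_le_count k nn S0) _; apply: le_trans (Hk s).
apply: ler_sum => r _; rewrite slope_incr mulrDr ler_nat.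
set x := _ + _ / _; have := slope_bound n x.
rewrite -(normrMsign s) ler_norml => /andP[_ Sn].
case: leP => // S1; case: leP => //; lra.
Qed.

End Crossing.

Lemma alpha_cvg0 : alpha R n @[n --> \oo] --> (0 : R).
Proof.
have h := @cvg_harmonic R.
rewrite (_ : @alpha R = (fun n => Num.sqrt (harmonic n))); last first.
  by apply/funext => n; rewrite /alpha sqrtrV.
rewrite -(sqrtr0 R); apply: (@continuous_cvg _ _ _ _ _ _ (@Num.sqrt R)) => //.
exact: sqrt_continuous.
Qed.

Lemma bad_small (p : nat) : exists k, (bad k 0 0)%:R <= (23 / 24) ^+ p * 2 ^+ k :> R.
Proof.
have c0 : osc_cst R * alpha R n @[n --> \oo] --> (0 : R).
  rewrite -(mulr0 (osc_cst R)); apply: cvgM; [exact: cvg_cst|exact: alpha_cvg0].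
have [n0 _ H0] : \forall n \near \oo, osc_cst R * alpha R n <= eps.
  move/cvgr0Pnorm_le/(_ _ eps0): c0; apply: filterS => n; apply: le_trans.
  exact: ler_norm.
(* The induction also carries [n0 <= k], so that [bad_ratio] applies at level [k] and gains one more
   factor 23/24. *)
suff [k _ Hk] : exists2 k, (n0 <= k)%N & (bad k 0 0)%:R <= (23 / 24) ^+ p * 2 ^+ k :> R.
  by exists k.
elim: p => [|p [k nk Hk]].
  by exists n0 => //; rewrite expr0 mul1r -natrX ler_nat bad_le.
have [k' Hk'] := bad_ratio (fun n => H0 n) nk.
exists (k + k')%N; first by rewrite (leq_trans nk)// leq_addr.
have d0 : dyadic 0 0 by exists 0%N; rewrite mul0r.
have c1 : 0 <= (23 / 24) * 2 ^+ k' :> R by rewrite mulr_ge0 ?exprn_ge0.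
apply: le_trans (bad_add c1 d0 _) _; first exact: Hk'.
apply: le_trans (ler_wpM2r c1 Hk) _.
by rewrite le_eqVlt; apply/orP; left; apply/eqP; rewrite exprS exprD; ring.
Qed.

Lemma small_image : exists N V : set T, [/\ measurable N, measurable V,
  (leb N <= (2 * eps)%:E)%E, (leb V <= eps%:E)%E &
  forall x, 0 <= x <= 1 -> ~ V x -> N (g x)].
Proof.
have c0 : ((23 / 24 : R) ^+ p) @[p --> \oo] --> (0 : R).
  by apply: cvg_expr; rewrite ger0_norm; lra.
move/cvgr0Pnorm_le/(_ _ eps0): c0 => [p _ /(_ p (leqnn p)) Hp].
have [k Hk] := bad_small p.
exists (cov k 0 0), (rest k 0 0); split.
- exact: measurable_cov.
- exact: measurable_rest.
- by apply: le_trans (lebesgue_cov _ _ _) _; rewrite expr0 mulr1.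
- apply: le_trans (lebesgue_rest _ _ _) _; rewrite lee_fin add0n.
  apply: le_trans (_ : (23 / 24) ^+ p * 2 ^+ k * q k <= _).
    by rewrite ler_wpM2r// ltW.
  rewrite -mulrA -exprMn mulfV// expr1n mulr1; apply: le_trans Hp.
  exact: ler_norm.
- by move=> x x01 Vx; apply: cov_rest => //; rewrite add0r expr0.
Qed.

End DyadicTree.

(** * Singularity of the image of Lebesgue measure *)

Section Singular.
Variable R : realType.
Local Notation leb := (@lebesgue_measure R).
Local Notation T := (measurableTypeR R).

(** Borel-Cantelli with tolerances [2 ^- k]: the upper limit of the covers [N k] is null since their
    measures are summable, and the exceptional set, the lower limit of the [V k], is null since each
    tail intersection lies in sets of arbitrarily small measure. The hypothesis on [g] admits both
    [symbol] and [lap_symbol]. *)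
Lemma null_image (g : R -> R) : (forall x y, `|g x - g y| = `|symbol x - symbol y|) ->
  exists Z N : set T, [/\ measurable Z, leb Z = 0%E, measurable N,
    leb N = 0%E & forall x, 0 <= x <= 1 -> ~ N x -> Z (g x)].
Proof.
move=> gE; pose e k : R := 2^-1 ^+ k.
have e0 k : 0 < e k by rewrite exprn_gt0.
have /choice[N /choice[V H]] k := small_image (e0 k) gE.
have mN k : measurable (N k) by have [] := H k.
have mV k : measurable (V k) by have [] := H k.
exists (lim_sup_set N), (\bigcup_n \bigcap_(k >= n) V k); split.
- by apply: bigcap_measurable => // n _; exact: bigcup_measurable.
- apply: lim_sup_set_cvg0 => //; apply: (@le_lt_trans _ _ 4%:E); last by rewrite ltry.
  apply: lime_le; first exact: is_cvg_nneseries.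
  apply: nearW => n; apply: le_trans (_ : (\sum_(0 <= k < n) (2 * e k)%:E <= _)%E).
    by apply: lee_sum => k _; have [] := H k.
  rewrite sumEFin lee_fin; have : \sum_(0 <= k < n) 2 * e k <= 4 - 4 * e n.
    elim: n => [|n IH]; first by rewrite big_geq// /e expr0; lra.
    by rewrite big_nat_recr//= {3}/e exprS -/(e n); lra.
  by have := e0 n; lra.
- by apply: bigcup_measurable => n _; apply: bigcap_measurableType.
- have mB n : measurable (\bigcap_(k >= n) V k) by exact: bigcap_measurableType.
  apply: measure_negligible; first exact: bigcup_measurable.
  apply: negligible_bigcup => n; exists (\bigcap_(k >= n) V k); split=> //.
  apply/eqP; rewrite eq_le measure_ge0 andbT; apply/lee_addgt0Pr => d d0.
  have [k _ Hk] : \forall k \near \oo, e k <= d.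
    move/cvgr0Pnorm_le/(_ _ d0): (@half_cvg0 R); apply: filterS => k; apply: le_trans.
    exact: ler_norm.
  have [_ _ _ lV _] := H (maxn n k).
  apply: (@le_trans _ _ (leb (V (maxn n k)))).
    apply: le_measure; rewrite ?inE//.
    by apply: bigcap_inf; rewrite /= leq_maxl.
  by rewrite add0e; apply: le_trans lV _; rewrite lee_fin; apply: Hk; rewrite /= leq_maxr.
- move=> x x01 nV n _; apply: contrapT => nN; apply: nV; exists n => // k nk.
  apply: contrapT => Vk; apply: nN; exists k => //.
  by have [_ _ _ _ ] := H k; apply.
Qed.

End Singular.

(** * Level sets of the symbol *)

Section LevelSets.
Variable R : realType.
Local Notation leb := (@lebesgue_measure R).
Local Notation T := (measurableTypeR R).
Local Notation tau := (@tau R).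
Implicit Types (x y h c : R) (i n p : nat).
Local Notation q n := ((2^-1 : R) ^+ n).

(** The translated measure agrees with Lebesgue measure on half-open intervals, hence on Borel sets
    by uniqueness. *)
Lemma lebesgue_translate (A : set T) h : measurable A ->
  leb [set x | A (x + h)] = leb A.
Proof.
move=> mA; pose t (x : T) : T := x + h.
have mt : measurable_fun setT t by apply: measurable_funD.
have -> : leb A = pushforward leb t A; last by [].
apply: (lebesgue_measure_unique (mu := pushforward leb t)) => // _ [[a b] _ <-].
rewrite [RHS](_ : _ = leb `]a - h, b - h]%classic); last first.
  by congr (leb _); apply/seteqP; split=> x /=; rewrite !in_itv/= /t ltrBlDr lerBrDr.
rewrite !lebesgue_measure_itv/= !lte_fin ltrD2r -!EFinB.
by case: ifP => // _; congr _%:E; ring.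
Qed.

Lemma negligible_subsingleton (A : set T) : (forall x y, A x -> A y -> x = y) ->
  leb.-negligible A.
Proof.
move=> A1; have [->|/set0P[x Ax]] := eqVneq A set0; first exact: negligible_set0.
exists [set x]; split; [exact: measurable_set1|exact: lebesgue_measure_set1|].
by move=> y Ay; exact: A1.
Qed.

Lemma poly_roots_seq (P : {poly R}) : P != 0 ->
  exists s : seq R, forall x, root P x -> x \in s.
Proof.
elim: {P}(size P) {-2}P (leqnn (size P)) => [|n IH] P.
  by rewrite leqn0 size_poly_eq0 => /eqP ->; rewrite eqxx.
move=> Pn P0; have [[x /factor_theorem[Q PQ]]|nr] := pselect (exists x, root P x).
  have Q0 : Q != 0 by apply: contra_neq P0 => Q0; rewrite PQ Q0 mul0r.
  have [|s Hs] := IH Q _ Q0.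
    by move: Pn; rewrite PQ size_Mmonic ?monicXsubC// size_XsubC addn2.
  exists (x :: s) => y; rewrite PQ rootM root_XsubC inE => /orP[/Hs ->|->//].
  by rewrite orbT.
by exists [::] => x Px; case: nr; exists x.
Qed.

Lemma cos_shift_pi m x : cos (x + m%:R * pi) = (-1) ^+ m * cos x.
Proof.
elim: m => [|m IH]; first by rewrite mul0r addr0 expr0 mul1r.
rewrite -natr1 mulrDl mul1r addrA cosDpi IH exprS; ring.
Qed.

(** While the phase runs through [[m pi, (m + 1) pi]] the cosine is injective, so each of these
    countably many pieces holds at most one point of the level set. *)
Lemma negligible_cos_level (d c : R) : 0 <= d ->
  leb.-negligible ([set x : R | 0 <= x /\ cos (tau * x + d) = c] : set T).
Proof.
move=> d0; have pi0 := pi_gt0 R; have t0 := tau_gt0 R.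
pose A m : set T := [set x : R |
  m%:R * pi <= tau * x + d <= m.+1%:R * pi /\ cos (tau * x + d) = c].
apply: (@negligibleS _ T R leb (\bigcup_m A m)); last first.
  apply: negligible_bigcup => m; apply: negligible_subsingleton => x y.
  move=> [/andP[x1 x2] xc] [/andP[y1 y2] yc].
  have key (z : R) : cos (tau * z + d) = c ->
      cos (tau * z + d - m%:R * pi) = (-1) ^+ m * c.
    by move=> <-; rewrite -[in RHS](subrK (m%:R * pi) (tau * z + d)) cos_shift_pi signrMK.
  have itv (z : R) : m%:R * pi <= z -> z <= m.+1%:R * pi -> z - m%:R * pi \in `[0, pi].
    by rewrite -natr1 mulrDl mul1r in_itv/= => z1 z2; apply/andP; split; lra.
  have : tau * x + d - m%:R * pi = tau * y + d - m%:R * pi.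
    by apply: cos_inj; [exact: itv|exact: itv|rewrite !key].
  by move=> /addIr/addIr/(mulfI (lt0r_neq0 t0)).
move=> x [x0 xc]; pose y := (tau * x + d) / pi.
have y0 : 0 <= y by rewrite divr_ge0 ?(ltW pi0)// addr_ge0// mulr_ge0// ltW.
have yE : tau * x + d = y * pi by rewrite /y divfK// gt_eqF.
exists (Num.truncn y) => //; split=> //; rewrite yE !ler_pM2r//.
have := truncn_itv y0; rewrite /= => /andP[-> /ltW ->]//.
Qed.

(* The Chebyshev polynomial of the second kind of degree [2 ^ i - 1]. *)
Fixpoint chebyshev i : {poly R} :=
  if i is i'.+1 then 2%:P * 'X * (chebyshev i' \Po (2%:P * 'X ^+ 2 - 1)) else 1.

(** Induction by angle doubling: [sin (2 y)] supplies the factor [2 cos y], and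
    [cos (2 y) = 2 cos^2 y - 1] the substitution in the recursion. *)
Lemma chebyshevE i y : sin (2 ^+ i * y) = sin y * (chebyshev i).[cos y].
Proof.
elim: i y => [|i IH] y /=; first by rewrite expr0 mul1r hornerC mulr1.
have -> : 2 ^+ i.+1 * y = 2 ^+ i * (y *+ 2) by rewrite exprS -mulr_natl; ring.
rewrite IH sin_mulr2n cos_mulr2n 2!hornerM hornerC hornerX horner_comp.
have -> : (2%:P * 'X ^+ 2 - 1).[cos y] = cos y ^+ 2 *+ 2 - 1.
  by rewrite hornerD hornerN hornerM !hornerC hornerXn; ring.
by ring.
Qed.

(** With the phase taken at the midpoint of [[x, x + 2 ^- p]], each term of the difference is a
    product of sines. For [i >= p] one factor is the sine of a multiple of [pi], so the sum is
    finite. *)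
Lemma symbol_diff p x : symbol (x + q p) - symbol x =
  sin (tau * x + pi * q p) * (\sum_(0 <= i < p)
    (- 4 * wt R i * sin (2 ^+ i * (pi * q p))) *: chebyshev i).[cos (tau * x + pi * q p)].
Proof.
set psi := tau * x + pi * q p.
have termE i : 2 * wt R i * cos (2 ^+ i * (tau * (x + q p)))
    - 2 * wt R i * cos (2 ^+ i * (tau * x))
    = - 4 * wt R i * sin (2 ^+ i * (pi * q p)) * sin (2 ^+ i * psi).
  have -> : 2 ^+ i * (tau * (x + q p)) = 2 ^+ i * psi + 2 ^+ i * (pi * q p).
    by rewrite /psi tauE; ring.
  have -> : 2 ^+ i * (tau * x) = 2 ^+ i * psi - 2 ^+ i * (pi * q p).
    by rewrite /psi; ring.
  by rewrite cosD cosB; ring.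
have sumE M : (p <= M)%N -> trig_sum M (x + q p) - trig_sum M x =
    \sum_(0 <= i < p) - 4 * wt R i * sin (2 ^+ i * (pi * q p)) * sin (2 ^+ i * psi).
  move=> pM; rewrite /trig_sum -sumrB (eq_bigr _ (fun i _ => termE i)).
  rewrite (big_cat_nat (leq0n p) pM)/= [X in _ + X](_ : _ = 0) ?addr0//.
  rewrite big_nat big1// => i /andP[pi' _].
  suff -> : sin (2 ^+ i * (pi * q p)) = 0 by rewrite mulr0 mul0r.
  have -> : 2 ^+ i * (pi * q p) = (2 ^ (i - p))%N%:R * pi.
    rewrite natrX -{1}(subnK pi') exprD exprVn; field; exact: pow2_neq0.
  elim: (2 ^ (i - p))%N => [|m IH]; first by rewrite mul0r sin0.
  by rewrite -natr1 mulrDl mul1r sinDpi IH oppr0.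
have c : trig_sum M (x + q p) - trig_sum M x @[M --> \oo] --> symbol (x + q p) - symbol x.
  by apply: cvgB; exact: trig_sum_cvg.
have -> : symbol (x + q p) - symbol x =
    \sum_(0 <= i < p) - 4 * wt R i * sin (2 ^+ i * (pi * q p)) * sin (2 ^+ i * psi).
  by apply: (cvg_unique _ c) => //; apply: cvg_near_cst; exists p => // M /= pM; exact: sumE.
rewrite horner_sum mulr_sumr; apply: eq_bigr => i _.
by rewrite hornerZ (chebyshevE i psi); ring.
Qed.

(** Equality makes [cos (tau x + d)] a root of a fixed nonzero polynomial, hence one of finitely
    many values, each taken on a null set. *)
Lemma negligible_symbol_diff p : (0 < p)%N ->
  leb.-negligible ([set x : R | 0 <= x /\ symbol (x + q p) = symbol x] : set T).
Proof.
move=> p0; set d := pi * q p; have d0 : 0 <= d by rewrite mulr_ge0 ?exprn_ge0 ?pi_ge0.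
pose Q := \sum_(0 <= i < p) (- 4 * wt R i * sin (2 ^+ i * d)) *: chebyshev i.
(* At 0 only the constant [chebyshev 0] survives, the others having a factor ['X]; its coefficient
   is nonzero because [0 < d < pi]. *)
have Q0 : Q.[0] != 0.
  rewrite /Q (big_ltn p0) hornerD horner_sum big_nat big1 => [|[|i] /andP[//] _ _]; last first.
    by rewrite hornerZ /= !hornerM hornerX mulr0 mul0r mulr0.
  rewrite addr0 hornerZ hornerC mulr1 expr0 mul1r !mulf_neq0 ?oppr_eq0 ?pnatr_eq0//.
    by rewrite gt_eqF// wt_gt0.
  have pi0 := pi_gt0 R; rewrite gt_eqF// sin_gt0_pi// mulr_gt0 ?exprn_gt0//=.
  rewrite -[ltRHS]mulr1 ltr_pM2l//; case: p p0 {d d0 Q} => // p _.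
  rewrite exprS; apply: le_lt_trans (_ : 2^-1 * 1 < 1); last by rewrite mulr1 invf_lt1 ?ltr1n.
  by rewrite ler_pM2l// exprn_ile1// invf_le1// ler1n.
(* The factor ['X ^+ 2 - 1] takes care of the zeros of the sine, where the cosine is [1] or [-1]. *)
have P0 : Q * ('X ^+ 2 - 1) != 0.
  apply: contra_neq Q0 => P0; have := congr1 (horner ^~ 0) P0.
  rewrite hornerM hornerD hornerN hornerC hornerXn expr0n/= sub0r horner0 => /eqP.
  by rewrite mulf_eq0 oppr_eq0 oner_eq0 orbF => /eqP.
have [s Hs] := poly_roots_seq P0.
(* Indices beyond the end of [s] give the default level 0, which only adds another null set. *)
pose A k : set T := [set x : R | 0 <= x /\ cos (tau * x + d) = nth 0 s k].
apply: (@negligibleS _ T R leb (\bigcup_k A k)).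
  move=> x [x0 xE]; have : root (Q * ('X ^+ 2 - 1)) (cos (tau * x + d)).
    have := symbol_diff p x; rewrite xE subrr -/d -/Q => /esym/eqP.
    rewrite mulf_eq0 rootE hornerM mulf_eq0 => /orP[/eqP sx|->//].
    apply/orP; right; rewrite !hornerE -[X in _ - X](cos2Dsin2 (tau * x + d)) sx.
    by rewrite expr0n addr0 subrr.
  move=> /Hs xs; exists (index (cos (tau * x + d)) s) => //=.
  by split=> //; rewrite nth_index.
by apply: negligible_bigcup => k; exact: negligible_cos_level.
Qed.

Lemma symbol_continuous : continuous (@symbol R).
Proof.
move=> x; apply/cvgrPdist_le => eps eps0; have e3 : 0 < eps / 3 by rewrite divr_gt0.
move/cvgr0Pnorm_le/(_ _ e3): (@half_cvg0 R) => [N _ /(_ N (leqnn N)) HN].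
have {}HN : q N <= eps / 3 by apply: le_trans HN; exact: ler_norm.
have ct : trig_sum N y @[y --> x] --> trig_sum N x.
  rewrite /trig_sum; apply: cvg_big => [|i _]; first exact: add_continuous.
  apply: cvgM; first exact: cvg_cst.
  by under eq_fun do rewrite mulrA; rewrite mulrA; exact: continuous_cosM.
move/cvgrPdist_le/(_ _ e3): ct; apply: filterS => y.
have := symbol_dist_half N x; have := symbol_dist_half N y.
rewrite !ler_norml; lra.
Qed.

(* For [h = 2 ^ - p], the level set [E] and its translate [E - h] meet in a null
   set, although both lie in the [2 h]-neighbourhood of [E], whose measure tends
   to that of [E]. *)
Lemma level_null c : exists N : set T, [/\ measurable N, leb N = 0%E &
  forall x, 0 <= x <= 1 -> symbol x = c -> N x].
Proof.
pose E : set T := [set x : R | 0 <= x <= 1 /\ symbol x = c].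
have mE : measurable E.
  have -> : E = `[0, 1]%classic `&` @symbol R @^-1` [set c].
    by apply/seteqP; split=> x /=; rewrite in_itv.
  apply: measurableI; first exact: measurable_itv.
  rewrite -[X in measurable X]setTI.
  exact: ((@bm_symbol R).1 measurableT _ (measurable_set1 c)).
exists E; split=> //.
(* The radius is twice the shift, so these open balls also cover the translate of [E]. *)
pose B p : set T := \bigcup_(y in E) ball y (2 * q p).
have mB p : measurable (B p).
  by apply: open_measurable; apply: bigcup_open => y _; exact: ball_open.
have EB p : E `<=` B p.
  by move=> x Ex; exists x => //; apply: ballxx; rewrite mulr_gt0 ?exprn_gt0.
have BE : \bigcap_p B p = E.
  (* [E] is closed by continuity of [symbol], so it is the intersection of its neighbourhoods. *)
  apply/seteqP; split=> [x Bx|x Ex p _]; last exact: EB.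
  have near_E (d : R) : 0 < d -> exists2 y : R, E y & `|y - x| < d.
    move=> d0; have d2 : 0 < d / 2 by rewrite divr_gt0.
    move/cvgr0Pnorm_lt/(_ _ d2): (@half_cvg0 R) => [p _ /(_ p (leqnn p)) Hp].
    have [y Ey yx] := Bx p I; exists y => //; apply: lt_trans yx _.
    by move: Hp; rewrite ltr_norml => /andP[_]; lra.
  split.
    apply/andP; split; apply/ler_addgt0Pr => d /near_E[y [/andP[y0 y1] _]];
      by rewrite ltr_norml; lra.
  apply/eqP; rewrite -subr_eq0 -normr_le0; apply/ler_addgt0Pr => d d0; rewrite add0r.
  have /cvgrPdist_le/(_ _ d0)/nbhs_ballP[r /= r0 Hr] := @symbol_continuous (x : R).
  have [y [_ <-] yx] := near_E r r0; apply: Hr.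
  by rewrite /ball/= distrC.
have Bfin : (leb (B 0%N) < +oo)%E.
  apply: (@le_lt_trans _ _ (leb `[(-3)%R, 4%R])).
    apply: le_measure; rewrite ?inE//.
    move=> x [y [/andP[y0 y1] _]]; rewrite /ball/= expr0 mulr1 ltr_norml in_itv/= => ?.
    by apply/andP; split; lra.
  by rewrite lebesgue_measure_itv/=; case: ifP => _; rewrite ?ltry// -EFinB ltry.
have Bcvg : leb (B p) @[p --> \oo] --> leb E.
  rewrite -BE; apply: nonincreasing_cvg_mu => //; first by rewrite BE.
  apply/nonincreasing_seqP => p; apply/subsetPset => x [y Ey yx]; exists y => //.
  by apply: le_ball yx; rewrite ler_pM2l// exprS ler_piMl ?exprn_ge0// invf_le1// ler1n.
have Efin : (leb E < +oo)%E.
  by apply: le_lt_trans Bfin; apply: le_measure; rewrite ?inE.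
have dbl p : (0 < p)%N -> (leb E + leb E <= leb (B p))%E.
  move=> p0; pose E' : set T := [set x : R | E (x + q p)].
  have mE' : measurable E'.
    rewrite -[X in measurable X]setTI; apply: (measurable_funD _ _ _ mE) => //.
  have EE' : leb E' = leb E by exact: lebesgue_translate.
  have I0 : leb (E `&` E') = 0%E.
    apply: measure_negligible; first exact: measurableI.
    apply: negligibleS (negligible_symbol_diff p0) => x [[/andP[x0 _] xc] [_ xc']].
    by split=> //; rewrite xc xc'.
  rewrite -[X in (_ + X <= _)%E]EE' -[X in (X <= _)%E]sube0 -I0 -measureUfinl//.
  apply: le_measure; rewrite ?inE//; first exact: measurableU.
  move=> x [Ex|Ex]; first exact: EB.
  exists (x + q p) => //; rewrite /ball/= addrAC subrr add0r ger0_norm ?exprn_ge0//.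
  by rewrite ltr_pMl ?exprn_gt0// ltr1n.
(* The limit of [dbl] in [p]; as [leb E] is finite, it must be 0. *)
have : (leb E + leb E <= leb E)%E.
  by apply: (cvge_to_ge Bcvg); exists 1%N => // p /= p0; exact: dbl.
have : (0 <= leb E)%E by exact: measure_ge0.
move: Efin; case: (leb E) => [r| |]//= _; rewrite -EFinD !lee_fin => r0 r2.
by congr _%:E; lra.
Qed.

End LevelSets.

Theorem theorem6p1 (R : realType) :
  purely_singular_continuous_spectrum (adjacency (@weight R)) /\
  purely_singular_continuous_spectrum (laplacian (@weight R)).
Proof.
have bh := @bm_hartley R; have ho := @hartley_orth R.
split.
  apply: (multiplication_purely_singular_continuous bh ho (multiplier_symbol R)).
  - exact: adjacency_operC.
  - exact: level_null.
  - exact: null_image.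
apply: (multiplication_purely_singular_continuous bh ho (multiplier_lap_symbol R)).
- exact: laplacian_operC.
- move=> c; have [N [mN N0 NE]] := level_null (total_weight R - c).
  by exists N; split=> // x x01 xc; apply: NE => //; rewrite -xc /lap_symbol subKr.
- apply: null_image => x y; rewrite /lap_symbol distrC.
  by congr (`|_|); ring.
Qed.
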